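(* Let $(X,d)$ be a non-empty complete metric space, let $\lambda\in(0,10^{-23})$, and let $\{f_1,f_2,f_3\}$ be a commuting $\lambda$-contractive family of operators on $X$. Then $f_1,f_2,f_3$ have a common fixed point, i.e. there is $x\in X$ with $f_1(x)=f_2(x)=f_3(x)=x$.
   Context: An operator on $X$ is a continuous function $X\to X$. Given $\lambda\in(0,1)$, a family $\{f_1,\dots,f_n\}$ of functions $X\to X$ is $\lambda$-contractive if for every pair of points $x,y\in X$ there is $i\in\{1,\dots,n\}$ such that $d(f_i(x),f_i(y))\le\lambda d(x,y)$. It is commuting if $f_i\circ f_j=f_j\circ f_i$ for all $i,j$. *)

(* Defs.v *)
From HB Require Import structures.
From mathcomp Require Import all_boot all_order all_algebra.
From mathcomp Require Import all_classical all_reals all_analysis.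

Set Implicit Arguments.
Unset Strict Implicit.
Unset Printing Implicit Defensive.

Import Order.TTheory GRing.Theory Num.Theory.

Local Open Scope classical_set_scope.
Local Open Scope ring_scope.

(* Non-empty complete metric spaces: [Complete] includes [Pointed], so the
   carrier is inhabited. *)
#[short(type="completeMetricType")]
HB.structure Definition CompleteMetric (R : numDomainType) :=
  {T of Complete T & Metric R T}.

Definition contractive_family (R : realType) (X : metricType R) (n : nat)
    (lambda : R) (f : 'I_n -> X -> X) : Prop :=
  forall x y : X, exists i : 'I_n, mdist (f i x) (f i y) <= lambda * mdist x y.

Definition commuting_family (X : Type) (n : nat) (f : 'I_n -> X -> X) : Prop :=
  forall i j : 'I_n, f i \o f j = f j \o f i.

(* Main.v *)
Require Import Defs.
From HB Require Import structures.
From mathcomp Require Import all_boot all_order all_algebra.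
From mathcomp Require Import all_classical all_reals all_analysis.
From mathcomp Require Import ring lra.

Import Order.TTheory GRing.Theory Num.Theory.

Set Implicit Arguments.
Unset Strict Implicit.
Unset Printing Implicit Defensive.

Local Open Scope classical_set_scope.
Local Open Scope ring_scope.

(** Why the three maps have a common fixed point.

    Say that i contracts (x, y) when d(f_i x, f_i y) <= lambda d(x, y), and let
    rho(x) = max_i d(x, f_i x) be the displacement.  Some f_i contracts (x, y),
    hence (1 - lambda) d(x, y) <= rho(x) + rho(y)
    ([distance_le_displacements]): points of small displacement are close to
    each other, and by completeness a common fixed point exists as soon as rho
    takes arbitrarily small values.  If a single f_i has a fixed point, the
    set of its fixed points is preserved by all maps and its pairs are
    contracted by the two other ones; two edges of the triangle x, f_j x, f_k x
    are contracted by the same map, and this map divides rho by two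
    ([fixed_point_extends]).  So assume that no f_i has a fixed point.
    Completeness then forbids every geometrically convergent sequence u whose
    terms are each moved geometrically little by one of the maps
    ([no_convergence]); from now on, every contradiction comes from this one.  Two
    instances: the steps of a line z, f_i z, f_i^2 z, ... cannot all be
    contracted by i, and two f_i-lines cannot carry opposite boolean labels
    when i contracts all pairs of different labels ([opposite_lines]).

    Choose p whose displacement is at most twice any other displacement in its
    orbit, and look at the orbit at that scale.  Two points x, y near p agree, up
    to a negligible error, in one of the coordinates f_1, f_2, f_3; so the
    triples (f_1 x, f_2 x, f_3 x) form a pairwise intersecting family.  No
    coordinate is the same for p, f_1 p, f_2 p, f_3 p, because f_i p would then
    have negligible displacement.  Such a family has a centre (P_1, P_2, P_3) from
    which three members depart, one in each coordinate ([triad]), and then two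
    cases are possible for the points near p.

    Majority: every triple has at least two coordinates at the centre.
    Commutation, f_i (f_j x) = f_j (f_i x), forces P_1 = P_2 = P_3
    ([majority_centre]).  Every point close to this common value is sent away
    from it by exactly one of the maps; some walk inside the cluster never
    changes this map ([constant_exit]), and the end of its almost shortest jump
    has too small a displacement ([common_centre_absurd]).

    Binary code: all four triples (of two letters in each coordinate) of even
    parity relative to p occur.  Commutation leaves three patterns
    ([fano_cases]).  In one of them the points f_j f_i^n p and f_k f_i^n p form
    opposite lines ([two_far_absurd]).  In the two others the orbit lies in two
    clusters which are small with respect to their distance.  The cluster
    chi(x) in {0, 1} satisfies chi(f_1 x) + chi(f_2 x) + chi(f_3 x) = 0, and a
    pair in one cluster whose types (chi(f_1 x), chi(f_2 x), chi(f_3 x)) differ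
    can only be contracted by the coordinate on which the types agree.

    Two clusters are impossible ([two_clusters_absurd]).  Pass to a sub-orbit
    Orb(y) on which no pair (cluster, type) can disappear any more.  The images
    under f_i of the points of one cluster, cut according to the cluster in
    which they land, are pieces of diameter at most 2 lambda delta, where
    delta bounds the diameters of the clusters; commuting squares make pieces
    overlap, so that a bounded number of them covers what remains of a cluster
    in Orb(f_1 f_2 f_3 y).  The diameters thus decrease geometrically along
    nested orbits, which contradicts [no_convergence].  When one cluster is far
    from p at the scale of rho(p), this needs points of displacement comparable
    to rho(p) in every sub-orbit; choosing the infimum of rho over an orbit almost
    maximal among the sub-orbits provides them ([no_system]). *)

(** * Indices, choices and minimal elements *)

Inductive ix := I1 | I2 | I3.

Definition distinct3 (i j k : ix) := [/\ i <> j, i <> k & j <> k].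

Lemma ix_cases i j k l : distinct3 i j k -> [\/ l = i, l = j | l = k].
Proof.
by case=> h1 h2 h3; case: i j k l h1 h2 h3 => - [] [] [] // _ _ _;
  (try by constructor 1); (try by constructor 2); (constructor 3).
Qed.

Lemma ix_other i : exists j k, distinct3 i j k.
Proof. by case: i; [exists I2, I3|exists I1, I3|exists I1, I2]. Qed.

Lemma ix_third i j : i <> j -> exists k, distinct3 i j k.
Proof.
by case: i j => - [] // _; [exists I3|exists I2|exists I3|exists I1|exists I2|exists I1].
Qed.

Lemma distinct213 i j k : distinct3 i j k -> distinct3 j i k.
Proof. by case=> *; split=> //; exact: nesym. Qed.

Lemma distinct132 i j k : distinct3 i j k -> distinct3 i k j.
Proof. by case=> *; split=> //; exact: nesym. Qed.

Lemma distinct231 i j k : distinct3 i j k -> distinct3 j k i.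
Proof. by case=> *; split=> //; exact: nesym. Qed.

Lemma distinct312 i j k : distinct3 i j k -> distinct3 k i j.
Proof. by case=> *; split=> //; exact: nesym. Qed.

Lemma distinct321 i j k : distinct3 i j k -> distinct3 k j i.
Proof. by case=> *; split=> //; exact: nesym. Qed.

(** Properties that can only be lost along [reach] are lost finitely often when
    there are finitely many of them. *)
Lemma stabilize (Y T : Type) (reach : Y -> Y -> Prop) (occurs : Y -> T -> Prop)
    (l : list T) :
  (forall x, reach x x) ->
  (forall y x z, reach x y -> reach y z -> reach x z) ->
  (forall x y t, reach x y -> occurs y t -> occurs x t) ->
  forall x, exists2 y, reach x y &
    forall t z, List.In t l -> reach y z -> occurs y t -> occurs z t.
Proof.
move=> rr rt mono; elim: l => [|t l IH] x; first by exists x.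
have [y xy hy] := IH x.
have [[z yz nz]|no] := pselect (exists2 z, reach y z & ~ occurs z t).
- exists z => [|t' z' /= [<-//|t'l] zz' ot']; first exact: rt yz.
  by apply: (hy t') => //; [apply: rt zz'|apply: mono ot'].
- exists y => // t' z' /= [<-|t'l] yz' ot'; last exact: (hy t').
  by apply: contrapT => nz; apply: no; exists z'.
Qed.

Section Reals.
Variable R : realType.
Implicit Types (b : nat -> R).

Lemma halving_decay b : (forall n, b n.+1 <= b n / 2) ->
  forall n, b n <= b 0%N * 2^-1 ^+ n.
Proof.
move=> hb; elim=> [|n IH]; first by rewrite expr0 mulr1.
rewrite exprSr mulrA; apply: le_trans (hb n) _.
by rewrite ler_pM2r// invr_gt0.
Qed.

(** Twice a positive infimum exceeds some value. *)
Lemma almost_min (Y : Type) (P : Y -> Prop) (N : Y -> R) (c : R) :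
  (exists y, P y) -> 0 < c -> (forall y, P y -> c <= N y) ->
  exists2 y, P y & forall u, P u -> N y <= 2 * N u.
Proof.
move=> [y0 Py0] c0 hc.
pose S := [set r | exists2 y, P y & r = N y]%classic.
have S0 : has_inf S.
  split; first by exists (N y0), y0.
  by exists c => r [y Py ->]; apply: hc.
have ic : c <= inf S.
  by apply: lb_le_inf; [case: S0|move=> r [y Py ->]; apply: hc].
have i0 : 0 < inf S by apply: lt_le_trans ic.
have [r [y Py ->] hr] := inf_adherent i0 S0.
exists y => // u Pu; have : inf S <= N u by apply: ge_inf; [case: S0|exists u].
by lra.
Qed.

End Reals.

(** * Contractive commuting systems *)

Section Dyn.
Variables (R : realType) (X : Type) (d : X -> X -> R) (g : ix -> X -> X) (lam : R).

Definition contracts i x y := d (g i x) (g i y) <= lam * d x y.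

(** The displacement of a point, called rho below. *)
Definition displacement x := Num.max (d x (g I1 x)) (Num.max (d x (g I2 x)) (d x (g I3 x))).

Definition in_orbit x y := exists w : seq ix, y = foldr g x w.

(** The commuting contractive family, once completeness and continuity have been
    used and fixed points of single maps have been excluded: both are
    summarized in [no_convergence]. *)
Record system : Prop := System {
  dxx : forall x, d x x = 0;
  dge0 : forall x y, 0 <= d x y;
  dsym : forall x y, d x y = d y x;
  dtri : forall y x z, d x z <= d x y + d y z;
  gC : forall i j x, g i (g j x) = g j (g i x);
  lam_gt0 : 0 < lam;
  lam_lt : lam <= 1 / 1000 / 1000 / 1000 / 1000;
  contractive : forall x y, exists i, contracts i x y;
  no_convergence : forall (u : nat -> X) (C : R),
    (forall n, d (u n) (u n.+1) <= C * 2^-1 ^+ n) ->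
    (forall n, exists i, d (u n) (g i (u n)) <= C * 2^-1 ^+ n) -> False }.

Lemma displacement_ge x i : d x (g i x) <= displacement x.
Proof. by rewrite /displacement !le_max; case: i; rewrite lexx ?orbT. Qed.

Lemma displacement_le x c : (forall i, d x (g i x) <= c) -> displacement x <= c.
Proof. by move=> h; rewrite /displacement !ge_max !h. Qed.

Lemma displacement_witness x c : c <= displacement x -> exists i, c <= d x (g i x).
Proof.
by rewrite /displacement !le_max => /or3P[]; [exists I1|exists I2|exists I3].
Qed.

Hypothesis sys : system.
Let dxx := dxx sys.
Let dge0 := dge0 sys.
Let dsym := dsym sys.
Let dtri := dtri sys.
Let gC := gC sys.
Let lam_gt0 := lam_gt0 sys.
Let contractive := contractive sys.
Let no_convergence := no_convergence sys.

Let lam_small := lam_lt sys.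

Lemma lam_monotone x y : x <= y -> lam * x <= lam * y.
Proof. by rewrite ler_pM2l. Qed.

Lemma lam_negligible x c : 0 <= x -> 1 / 1000 / 1000 / 1000 / 1000 <= c -> lam * x <= c * x.
Proof. by move=> x0 hc; apply: ler_wpM2r => //; apply: le_trans lam_small hc. Qed.

Lemma contr_sym i x y : contracts i x y -> contracts i y x.
Proof. by rewrite /contracts (dsym x) (dsym (g i x)). Qed.

Lemma orb_refl x : in_orbit x x.
Proof. by exists [::]. Qed.

Lemma orb_step i x y : in_orbit x y -> in_orbit x (g i y).
Proof. by case=> w ->; exists (i :: w). Qed.

Lemma orb_g i x : in_orbit x (g i x).
Proof. exact/orb_step/orb_refl. Qed.

Lemma orb_trans y x z : in_orbit x y -> in_orbit y z -> in_orbit x z.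
Proof. by move=> [w ->] [v ->]; exists (v ++ w); rewrite foldr_cat. Qed.

Lemma orb_ind x (P : X -> Prop) :
  P x -> (forall i y, in_orbit x y -> P y -> P (g i y)) -> forall y, in_orbit x y -> P y.
Proof.
move=> P0 PS y [w ->]; elim: w => [//|i w IH] /=.
by apply: PS => //; exists w.
Qed.

(** This is where passing from an orbit to a deeper one gives control: all the
    points of the deeper orbit have a predecessor. *)
Lemma orb_image i x y : in_orbit (g i x) y -> exists2 z, in_orbit x z & y = g i z.
Proof.
move: y; apply: orb_ind => [|j y _ [z xz ->]]; first by exists x => //; apply: orb_refl.
by exists (g j z); [apply: orb_step|rewrite gC].
Qed.

Lemma orb_iter y n l z : in_orbit y z -> in_orbit y (iter n (g l) z).
Proof. by move=> oz; elim: n => //= n; apply: orb_step. Qed.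

Lemma iterC a b n x : iter n (g a) (g b x) = g b (iter n (g a) x).
Proof. by elim: n => //= n ->; rewrite gC. Qed.

(** Follow x, f_i x, f_i y, y for a map f_i contracting (x, y). *)
Lemma distance_le_displacements x y : (1 - lam) * d x y <= displacement x + displacement y.
Proof.
have [i ci] := contractive x y.
have h1 := dtri (g i x) x y; have h2 := dtri (g i y) (g i x) y.
have h3 := displacement_ge x i; have h4 := displacement_ge y i; rewrite dsym in h4.
move: ci; rewrite /contracts; lra.
Qed.

Lemma contracted_line i z : 
  (forall n, contracts i (iter n (g i) z) (iter n.+1 (g i) z)) -> False.
Proof.
move=> h; have ll := lam_small.
pose b n := d (iter n (g i) z) (iter n.+1 (g i) z).
have hb : forall n, b n.+1 <= b n / 2.
  move=> n; have : b n.+1 <= lam * b n by exact: h.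
  have : 0 <= b n by exact: dge0.
  nra.
apply: (no_convergence (halving_decay hb)) => n; exists i; exact: halving_decay hb n.
Qed.

(** The distance between the n-th points of the lines decreases by the factor
    lam at each step. The next step of the first line is contracted directly
    when its ends have different labels, and otherwise by way of the point
    of the second line at the same level, so the steps decrease
    geometrically. *)
Lemma opposite_lines i z z' (s : nat -> bool) :
  (forall n m, s n != s m -> contracts i (iter n (g i) z) (iter m (g i) z)) ->
  (forall n m, s n = s m -> contracts i (iter n (g i) z) (iter m (g i) z')) ->
  False.
Proof.
move=> h1 h2; have ll := lam_small.
pose a n := d (iter n (g i) z) (iter n (g i) z').
pose e n := d (iter n (g i) z) (iter n.+1 (g i) z).
have a0 n : 0 <= a n by exact: dge0.
have e0 n : 0 <= e n by exact: dge0.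
have ha n : a n.+1 <= lam * a n by apply: h2.
have he n : e n.+1 <= lam * (e n + 2 * a n).
  have [es|ns] := eqVneq (s n) (s n.+1).
    have := h2 _ _ es; rewrite /contracts -!iterS => hc.
    have := dtri (iter n.+2 (g i) z') (iter n.+1 (g i) z) (iter n.+2 (g i) z).
    rewrite (dsym (iter n.+2 (g i) z') (iter n.+2 (g i) z)) -/(a n.+2) -/(e n.+1).
    have := dtri (iter n.+1 (g i) z) (iter n (g i) z) (iter n.+1 (g i) z').
    rewrite -/(a n.+1) -/(e n) => h3 h4.
    have h5 := ha n; have h6 := ha n.+1.
    have h7 : a n.+1 <= a n by apply: le_trans h5 _; have := lam_negligible (a0 n) (c := 1); lra.
    have h8 := lam_monotone h7; have := lam_monotone h3; rewrite -/(e n) => h9.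
    lra.
  have := h1 _ _ ns; rewrite /contracts -!iterS -/(e n.+1) -/(e n).
  have : lam * e n <= lam * (e n + 2 * a n) by apply: lam_monotone; have := a0 n; lra.
  lra.
pose b n := e n + a n.
have hb n : b n.+1 <= b n / 2.
  have e2 : 0 <= e n + 2 * a n by have := a0 n; have := e0 n; lra.
  rewrite /b; have := lam_negligible (a0 n) (c := 1 / 8); have := lam_negligible e2 (c := 1 / 8).
  have := he n; have := ha n; have := a0 n; have := e0 n; lra.
apply: (no_convergence (u := fun n => iter n (g i) z) (C := b 0%N)) => n; last exists i;
  by apply: le_trans (halving_decay hb n); rewrite lerDl.
Qed.
End Dyn.

Lemma dependent_choice_nat (Y : Type) (S : nat -> Y -> Prop) (rel : Y -> Y -> Prop) x :
  S 0%N x -> (forall n y, S n y -> exists2 y', S n.+1 y' & rel y y') ->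
  exists u : nat -> Y, forall n, S n (u n) /\ rel (u n) (u n.+1).
Proof.
move=> S0 step.
pose nxt n (y : {y | S n y}) : {y' | S n.+1 y' /\ rel (sval y) y'} :=
  cid (let: ex_intro2 y' a b := step n (sval y) (svalP y) in ex_intro _ y' (conj a b)).
pose fix U n : {y | S n y} :=
  if n is m.+1 then exist _ (sval (nxt m (U m))) (proj1 (svalP (nxt m (U m))))
  else exist _ x S0.
exists (fun n => sval (U n)) => n; split; first exact: (svalP (U n)).
exact: (proj2 (svalP (nxt n (U n)))).
Qed.

(** * Sets with exactly one way out at each point *)

Section TwoWay.
Variables (R : realType) (X : Type) (d : X -> X -> R) (g : ix -> X -> X) (lam : R).
Hypothesis sys : system d g lam.
Let dge0 := dge0 sys.
Let dsym := dsym sys.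
Let dtri := dtri sys.
Let gC := gC sys.

Variables (m : X -> ix).

(** Paths that never take the exit [m] of the point at which they are. *)
Inductive walk (x : X) : X -> Prop :=
| walk0 : walk x x
| walkS i y : walk x y -> i <> m y -> walk x (g i y).

Lemma walk_trans y x z : walk x y -> walk y z -> walk x z.
Proof. by move=> xy; elim=> // i t _ xt it; apply: walkS. Qed.

Lemma walk_orb x y : walk x y -> in_orbit g x y.
Proof. by elim=> [|i t _ xt _]; [apply: orb_refl|apply: orb_step]. Qed.

Variables (P : X -> Prop) (M : R).
Hypothesis hP : forall x, P x -> forall i, P (g i x) <-> i <> m x.
Hypothesis hc : forall x u, P x -> P u -> m x <> m u -> ~ contracts d g lam (m x) x u.
Hypothesis hM : forall x u, P x -> P u -> d x u <= M.

Lemma walkP x y : P x -> walk x y -> P y.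
Proof. by move=> Px; elim=> // i t _ Pt it; apply/hP. Qed.

(** Neither exit contracts a pair with different exits: one image of the pair
    leaves the set and the other one does not. *)
Lemma contr_third i j k x u : distinct3 i j k -> P x -> P u -> m x = i -> m u = j ->
  contracts d g lam k x u.
Proof.
move=> [ij ik jk] Px Pu mx mu; have [l hl] := contractive sys x u.
have [li|lj|<-//] := ix_cases l (And3 ij ik jk).
- by case: (hc Px Pu); rewrite ?mx ?mu // -li.
- by case: (hc Pu Px); rewrite ?mx ?mu; [exact: nesym|rewrite -lj; apply: contr_sym sys _ _ _ hl].
Qed.

(** Whether f_i f_j x stays in the set does not depend on the order of the maps. *)
Lemma walk_square x i j : P x -> i <> m x -> j <> m x -> i <> m (g j x) <-> j <> m (g i x).
Proof.
move=> Px ix jx; have Pi : P (g i x) by apply/hP. have Pj : P (g j x) by apply/hP.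
by rewrite -(hP Pj) -(hP Pi) gC.
Qed.

(** When k is never an exit, the exits are constant along f_k-lines: if x exits
    by i then f_j x, hence f_k f_j x = f_j f_k x, stays inside, so that f_k
    x does not exit by j. Lines with different exits are opposite. *)
Lemma two_types x i j k : P x -> distinct3 i j k -> 
  (forall y, walk x y -> m y <> k) ->
  (exists2 y, walk x y & m y = i) -> (exists2 y, walk x y & m y = j) -> False.
Proof.
move=> Px D nk; have [ij ik jk] := D.
have key i' j' v : distinct3 i' j' k -> walk x v -> m v = i' -> 
    forall n, walk x (iter n (g k) v) /\ m (iter n (g k) v) = i'.
  move=> D' xv mv; have [ij' ik' jk'] := D'; elim=> [//|n [xw mw]] /=.
  set w := iter n (g k) v in xw mw *.
  have Pw := walkP Px xw.
  have kw : k <> m w by rewrite mw; exact: nesym.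
  have jw : j' <> m w by rewrite mw; exact: nesym.
  have xkw : walk x (g k w) by apply: walkS.
  split=> //.
  have : k <> m (g j' w) by apply/nesym/nk/walkS.
  move/(walk_square Pw kw jw) => h.
  by have [//|e|e] := ix_cases (m (g k w)) D'; [case: h|case: (nk _ xkw)].
move=> [v xv mv] [w xw mw].
have kv := key _ _ _ D xv mv.
have kw := key _ _ _ (And3 (nesym ij) jk ik) xw mw.
apply: (opposite_lines sys (i := k) (z := v) (z' := w) (s := fun=> true)) => [n n' //|n n' _].
have [xv' mv'] := kv n; have [xw' mw'] := kw n'.
exact: contr_third D (walkP Px xv') (walkP Px xw') mv' mw'.
Qed.

Section ThreeTypes.
Variables (x : X) (Pi : R).
Hypothesis Px : P x.
Hypothesis full : forall t, exists2 z, walk x z & m z = t.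
Hypothesis hPi : forall u v, walk x u -> walk x v -> d u v <= Pi.

Let link i j := exists z, [/\ walk x z, i <> m z, j <> m z & i <> m (g j z)].

Lemma link_sym i j : link i j -> link j i.
Proof. by move=> [z [xz iz jz ij]]; exists z; split=> //; apply/(walk_square (walkP Px xz)). Qed.

(** Two points with different exits, both different from i, are contracted by i;
    two points with the same exit are compared with a third one. *)
Lemma class_image i v v' : walk x v -> walk x v' -> i <> m v -> i <> m v' ->
  d (g i v) (g i v') <= 2 * lam * Pi.
Proof.
have Pi0 : 0 <= Pi by apply: le_trans (hPi (walk0 x) (walk0 x)).
have lP : 0 <= lam * Pi by apply: mulr_ge0 => //; apply/ltW/(lam_gt0 sys).
have key u u' : walk x u -> walk x u' -> i <> m u -> i <> m u' -> m u <> m u' ->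
    d (g i u) (g i u') <= lam * Pi.
  move=> xu xu' iu iu' uu'.
  have D : distinct3 (m u) (m u') i by split=> //; exact: nesym.
  have := contr_third D (walkP Px xu) (walkP Px xu') erefl erefl.
  by move=> h; apply: le_trans h _; apply: (lam_monotone sys); apply: hPi.
move=> xv xv' iv iv'; have [e|] := pselect (m v = m v'); last first.
  by move=> ne; have := key _ _ xv xv' iv iv' ne; lra.
have [k [a1 a2 a3]] := ix_third iv.
have [z xz mz] := full k.
have h1 : d (g i v) (g i z) <= lam * Pi by apply: key; rewrite ?mz.
have h2 : d (g i z) (g i v') <= lam * Pi by apply: key; rewrite ?mz -?e //; exact: nesym.
by have := dtri (g i z) (g i v) (g i v'); lra.
Qed.

(** If f_k f_i and f_k f_j always leave the set when they may, then f_k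
    exchanges the points with exit i and those with exit j; all the steps of
    an f_k-line are then contracted by k. *)
Lemma linked k i j : distinct3 i j k -> link k i \/ link k j.
Proof.
move=> D; have [ij ik jk] := D; apply: contrapT => /not_orP[n1 n2].
have alt i' j' v : distinct3 i' j' k -> ~ link k i' -> walk x v -> m v = j' -> m (g k v) = i'.
  move=> [ij' ik' jk'] nl xv mv; apply: contrapT => h; apply: nl.
  by exists v; split; rewrite ?mv //; [exact: nesym|apply/(walk_square (walkP Px xv)); rewrite ?mv//; exact: nesym].
have key v : walk x v -> m v = i \/ m v = j -> walk x (g k v) /\ 
    (m v = i /\ m (g k v) = j \/ m v = j /\ m (g k v) = i).
  move=> xv h; split; first by apply: walkS => //; case: h => ->; exact: nesym.
  case: h => mv; [left|right]; split=> //; last exact: alt n1 xv mv.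
  exact: alt (And3 (nesym ij) jk ik) n2 xv mv.
have [z xz mz] := full i.
have line n : walk x (iter n (g k) z) /\ (m (iter n (g k) z) = i \/ m (iter n (g k) z) = j).
  elim: n => [|n [xw mw]]; first by split=> //; left.
  by have [xw' h] := key _ xw mw; split=> //=; case: h => -[_ ->]; [right|left].
apply: (contracted_line sys (i := k) (z := z)) => n; have [xw mw] := line n.
have [xw' h] := key _ xw mw; case: h => -[e1 e2].
  exact: contr_third D (walkP Px xw) (walkP Px xw') e1 e2.
exact: contr_third (And3 (nesym ij) jk ik) (walkP Px xw) (walkP Px xw') e1 e2.
Qed.

(** Everything reached by at least one step is in one of the three small sets of
    [class_image], and a corner f_i f_j z belonging to two of them links
    them; by [linked] at least two of the three links exist. *)
Lemma walk_shrink y u v : (exists2 i, y = g i x & i <> m x) -> walk y u -> walk y v ->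
  d u v <= 6 * lam * Pi.
Proof.
move=> [i0 -> i0x].
have Pi0 : 0 <= Pi by apply: le_trans (hPi (walk0 x) (walk0 x)).
have lP : 0 <= lam * Pi by apply: mulr_ge0 => //; apply/ltW/(lam_gt0 sys).
have im w : walk (g i0 x) w -> exists i v, [/\ walk x v, i <> m v & w = g i v].
  case=> [|i t xt it]; first by exists i0, x; split=> //; apply: walk0.
  by exists i, t; split=> //; apply: walk_trans xt; apply: walkS => //; apply: walk0.
move=> /im[i [u' [xu iu ->]]] /im[j [v' [xv jv ->]]].
have [e|ij] := pselect (i = j).
  by subst j; have := class_image xu xv iu jv; lra.
have [k D] := ix_third ij; have [_ ik jk] := D.
have [[z [xz iz jz ijz]]|nl] := pselect (link i j).
  have xi : walk x (g i z) by apply: walkS.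
  have xj : walk x (g j z) by apply: walkS.
  have jiz : j <> m (g i z) by apply/(walk_square (walkP Px xz)).
  have := class_image xu xj iu ijz; have := class_image xi xv jiz jv.
  by have := dtri (g i (g j z)) (g i u') (g j v'); rewrite gC; lra.
have lik : link i k by case: (linked (And3 jk (nesym ij) (nesym ik))) => //.
have ljk : link j k.
  have [|//] := linked (And3 ik ij (nesym jk)); by move/link_sym.
move: lik => [z [xz iz kz ikz]]; move: ljk => [w [xw jw kw jkw]].
have kiz : k <> m (g i z) by apply/(walk_square (walkP Px xz)).
have kjw : k <> m (g j w) by apply/(walk_square (walkP Px xw)).
have b1 := class_image xu (walkS xz kz) iu ikz.
have b2 := class_image (walkS xz iz) (walkS xw jw) kiz kjw.
have b3 := class_image (walkS xw kw) xv jkw jv.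
rewrite (gC i k) in b1; rewrite (gC j k) in b3.
have := dtri (g k (g i z)) (g i u') (g j v').
have := dtri (g k (g j w)) (g k (g i z)) (g j v'); lra.
Qed.
End ThreeTypes.

(** If the exits keep varying, only two of them occur somewhere, which
    [two_types] excludes, or all three occur forever; then [walk_shrink]
    gives nested sets of geometrically small diameter. *)
Theorem constant_exit x0 : P x0 ->
  exists x k, [/\ walk x0 x, P x & forall y, walk x y -> m y = k].
Proof.
move=> Px0; apply: contrapT => no.
pose occurs x t := exists2 y, walk x y & m y = t.
have [x x0x st] := @stabilize X ix walk occurs [:: I1; I2; I3] walk0 walk_trans
  (fun x y t xy oy => let: ex_intro2 z yz mz := oy in ex_intro2 _ _ z (walk_trans xy yz) mz) x0.
have st' t z : walk x z -> occurs x t -> occurs z t.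
  by move=> xz; apply: st => //; case: t => /=; tauto.
have Px := walkP Px0 x0x.
have full t : occurs x t.
  apply: contrapT => nt.
  have [i [j D]] := ix_other t; have [ti tj ij] := D.
  have nt' y : walk x y -> m y <> t by move=> xy e; apply: nt; exists y.
  have [oi|noi] := pselect (occurs x i); last first.
    apply: no; exists x, j; split=> // y xy.
    by have [/(nt' _ xy)|e|] := ix_cases (m y) D; [|case: noi; exists y|].
  have [oj|noj] := pselect (occurs x j); last first.
    apply: no; exists x, i; split=> // y xy.
    by have [/(nt' _ xy)||e] := ix_cases (m y) D; [| |case: noj; exists y].
  by apply: (two_types Px (And3 ij (nesym ti) (nesym tj)) nt').
pose S n y := [/\ walk x y & forall u v, walk y u -> walk y v -> d u v <= M * 2^-1 ^+ n].
have S0 : S 0%N x.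
  by split=> [|u v xu xv]; [apply: walk0|rewrite expr0 mulr1; apply: hM; exact: walkP xu || exact: walkP xv].
have step n y : S n y -> exists2 y', S n.+1 y' & exists2 i, y' = g i y & i <> m y.
  move=> [xy by_]; have Py := walkP Px xy.
  have [i [j [ij _ _]]] := ix_other (m y).
  exists (g i y); last by exists i => //; exact: nesym.
  split=> [|u v yu yv]; first by apply: walkS => //; exact: nesym.
  have fy t : exists2 z, walk y z & m z = t by apply: st'.
  have := walk_shrink Py fy by_ (ex_intro2 _ _ i erefl (nesym ij)) yu yv.
  have b0 : 0 <= M * 2^-1 ^+ n by apply: le_trans (by_ _ _ (walk0 y) (walk0 y)).
  have := lam_negligible sys b0 (c := 1 / 12); rewrite exprSr mulrA; lra.
have [u hu] := dependent_choice_nat S0 step.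
apply: (no_convergence sys (u := u) (C := M)) => n; have [[xu bu] [i e im]] := hu n.
  by rewrite e; apply: bu; [apply: walk0|apply: walkS => //; apply: walk0].
by exists i; apply: bu; [apply: walk0|apply: walkS => //; apply: walk0].
Qed.
End TwoWay.

(** * Finite combinatorics near an almost minimal point *)

Section Local.
Variables (X : Type) (g : ix -> X -> X) (p : X).
Variables (ok : X -> Prop) (T : X -> X -> Prop) (B : X -> Prop).

(** A value Z of the picture far from p introduces a larger scale, on which all
    the near points collapse; [nr] and [fr] are the neighbourhoods of the
    near points and of Z at this scale. In [cross] a map contracts the pair
    (w, V), where w is near and V is at Z. *)
Record scales (Z : X) (nr fr : X -> Prop) : Prop := Scales {
  nrfr : forall v, nr v -> fr v -> False;
  Bnr : forall v, B v -> nr v;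
  Zfr : forall v, T v Z -> fr v;
  cross : forall w V, ok w -> ok V -> B w -> T V Z ->
    exists i, (B (g i w) -> nr (g i V)) /\ (T (g i w) Z -> fr (g i V)) }.

(** What contractivity says about the points f^w p with w a short word, with all
    numerical estimates removed. T means being equal up to negligible errors
    and B being near p; both are exact equivalence classes, because they are
    defined by chains in a finite set of points. [ok] holds for the words of
    length at most two, whose images still belong to this finite set. *)
Record local_picture : Prop := LocalPicture {
  picture_comm : forall i j x, g i (g j x) = g j (g i x);
  sameR : forall x, T x x;
  sameS : forall x y, T x y -> T y x;
  sameT : forall y x z, T x y -> T y z -> T x z;
  BT : forall x y, B x -> T x y -> B y;
  ok0 : ok p;
  ok1 : forall i, ok (g i p);
  ok2 : forall i j, ok (g i (g j p));
  B0 : B p;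
  B1 : forall i, B (g i p);
  moving : forall x, ok x -> ~ (forall i, T x (g i x));
  far_scales : forall x i, ok x -> ~ B (g i x) -> exists nr fr, scales (g i x) nr fr }.

Hypothesis L : local_picture.
Let gC := picture_comm L.
Let sameR := sameR L.
Let sameS := sameS L.
Let sameT := sameT L.
Let BT := BT L.
Let ok0 := ok0 L.
Let ok1 := ok1 L.
Let ok2 := ok2 L.
Let B0 := B0 L.
Let B1 := B1 L.

Lemma near_same_sym x y : B x -> T y x -> B y.
Proof. by move=> Bx /sameS; apply: BT. Qed.

Lemma not_moving i j k x : ok x -> distinct3 i j k ->
  T x (g i x) -> T x (g j x) -> T x (g k x) -> False.
Proof.
by move=> ox D xi xj xk; apply: (moving L ox) => l; case: (ix_cases l D) => ->.
Qed.

(** ** The majority case *)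

Section Majority.
Variable P : ix -> X.
Hypothesis maj : forall w i j, ok w -> B w -> i <> j -> T (g i w) (P i) \/ T (g j w) (P j).

Lemma on_centre w i j : ok w -> B w -> i <> j -> ~ T (g i w) (P i) -> T (g j w) (P j).
Proof. by move=> ow Bw ij n; case: (maj ow Bw ij). Qed.

(** f_i f_j w cannot be both at P_i and at P_j. *)
Lemma commuting_square w i j : ok (g i w) -> ok (g j w) -> ~ T (P i) (P j) ->
  ~ T (g i (g j w)) (P i) \/ ~ T (g j (g i w)) (P j).
Proof.
move=> oi oj nij; apply: contrapT => /not_orP[/contrapT a /contrapT b].
by apply: nij; apply: sameT (sameS a) _; rewrite gC.
Qed.

(** Since f_k p is near, p is off the centre at k. If f_k p were not off at i,
    then f_i p would be sent to its own place by all the maps; so f_k p is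
    off at i, and also at j by symmetry. *)
Lemma far_centre_equal i j k : distinct3 i j k -> T (P i) (P j) -> ~ B (P k) -> False.
Proof.
move=> D Pij nB; have [ij ik jk] := D.
have nk w : B w -> ~ T w (P k) by move=> Bw wk; apply: nB; apply: BT Bw wk.
have pi : T (g i p) (P i) by apply: (on_centre ok0 B0 (nesym ik)); exact: nk.
have pj : T (g j p) (P j) by apply: (on_centre ok0 B0 (nesym jk)); exact: nk.
have BPi : B (P i) by apply: BT (B1 i) pi.
have nPik : ~ T (P k) (P i) by move=> /sameS; exact: nk.
have key a b : a <> b -> distinct3 a b k -> T (g a p) (P a) -> T (P a) (P b) -> B (P a) -> 
   ~ T (g a (g k p)) (P a).
  move=> ab [_ ak bk] pa Pab BPa h.
  have nka : ~ T (g k (g a p)) (P k).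
    by rewrite gC => h'; apply: (nk _ BPa); apply: sameT (sameS h) h'.
  have xa := on_centre (ok1 a) (B1 a) (nesym ak) nka.
  have xb := on_centre (ok1 a) (B1 a) (nesym bk) nka.
  apply: (not_moving (ok1 a) (And3 ab ak bk)).
  - exact: sameT pa (sameS xa).
  - by apply: sameT pa _; apply: sameT Pab _; exact: sameS.
  - by rewrite gC; apply: sameT pa (sameS h).
have a := key i j ij D pi Pij BPi.
have b := key j i (nesym ij) (And3 (nesym ij) jk ik) pj (sameS Pij) (BT BPi Pij).
by case: (maj (ok1 k) (B1 k) ij).
Qed.

(** The points V = f_k f_i p and V' = f_k f_k p are at the far centre P_k.
    Comparing them at the larger scale with p, f_i p and f_k p determines
    their images ([lem]) as soon as f_j V or f_j V' is far; the two
    alternatives for the square at f_j p then contradict f_i V' = f_k V,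
    respectively give two incompatible places for f_i f_i f_j p. *)
Lemma far_centre_case i j k : distinct3 i j k -> ~ T (P i) (P j) -> ~ B (P k) ->
  ~ T (g j (g i p)) (P j) -> False.
Proof.
move=> D nij nB nji; have [ij ik jk] := D.
have nk w : B w -> ~ T w (P k) by move=> Bw wk; apply: nB; apply: BT Bw wk.
have nkT w v : B w -> T v w -> ~ T v (P k) by move=> Bw vw; apply/nk/(near_same_sym Bw).
have pi : T (g i p) (P i) by apply: (on_centre ok0 B0 (nesym ik)); exact: nk.
have pj : T (g j p) (P j) by apply: (on_centre ok0 B0 (nesym jk)); exact: nk.
have BPi : B (P i) by apply: BT (B1 i) pi.
have BPj : B (P j) by apply: BT (B1 j) pj.
have ii := on_centre (ok1 i) (B1 i) (nesym ij) nji.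
have ki := on_centre (ok1 i) (B1 i) jk nji.
have nik : ~ T (g i (g k p)) (P i) by rewrite gC => h; apply: (nk _ BPi); apply: sameT (sameS h) ki.
have jk' := on_centre (ok1 k) (B1 k) ij nik.
have kk := on_centre (ok1 k) (B1 k) ik nik.
have nkj : ~ T (g k (g j p)) (P k) by rewrite gC; exact: nkT jk'.
have ij' := on_centre (ok1 j) (B1 j) (nesym ik) nkj.
have jj := on_centre (ok1 j) (B1 j) (nesym jk) nkj.
set V := g k (g i p) in ki; set V' := g k (g k p) in kk.
have nBV : ~ B V by move=> h; apply: (nk _ h).
have [nr [fr S]] := far_scales L (ok1 i) nBV.
have PkV : T (P k) V by exact: sameS.
have frk v : T v (P k) -> fr v by move=> h; apply: (Zfr S); apply: sameT h PkV.
have nrB v w : B w -> T v w -> nr v by move=> Bw h; apply: (Bnr S); apply: near_same_sym Bw h.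
have Bij : B (g i (g j p)) by apply: near_same_sym ij'.
have Bii : B (g i (g i p)) by apply: near_same_sym ii.
have Bjk : B (g j (g k p)) by apply: near_same_sym jk'.
have Bjj : B (g j (g j p)) by apply: near_same_sym jj.
have TkV : T (g i (g k p)) V by rewrite /V gC.
have V'V : T V' V by apply: sameT kk PkV.
have lem W : ok W -> T W V -> fr (g j W) -> nr (g i W) /\ fr (g k W).
  move=> oW WV fj; have nj : ~ nr (g j W) by move=> h; apply: (nrfr S h fj).
  have a1 : nr (g i W) \/ nr (g k W).
    have [l [h _]] := cross S ok0 oW B0 WV; have {}h := h (B1 l).
    by case: (ix_cases l D) h => -> h; [left| |right].
  have a2 : fr (g i W) \/ fr (g k W).
    have [l [hb hf]] := cross S (ok1 k) oW (B1 k) WV.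
    case: (ix_cases l D) hb hf => -> hb hf; [left|by case: nj; apply: hb|right]; apply: hf => //.
  have a3 : nr (g i W) \/ fr (g k W).
    have [l [hb hf]] := cross S (ok1 i) oW (B1 i) WV.
    case: (ix_cases l D) hb hf => -> hb hf; [left; exact: hb|case: nj; apply: hb; rewrite gC; exact: Bij|right; apply: hf; exact: sameR].
  have nf := nrfr S; case: a1 => a1; first by split=> //; case: a2 => // /(nf _ a1).
  by case: a3 => [a3|/(nf _ a1) //]; split=> //; case: a2 => // /(nf _ a3).
have oV : ok V by exact: ok2.
have oV' : ok V' by exact: ok2.
have [c|c] := commuting_square (ok2 i j) (ok2 j j) nij; last first.
(* Then f_j V and f_j V' are far, so that f_i V' = f_k V is near and far. *)
- have kij := on_centre (ok2 i j) Bij jk c.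
  have fV : fr (g j V) by apply: frk; rewrite /V gC (gC j i).
  have nikj : ~ T (g i (g k (g j p))) (P i).
    by rewrite gC => h; apply: (nk _ BPi); apply: sameT (sameS h) kij.
  have Bkj : B (g k (g j p)) by rewrite gC.
  have kkj := on_centre (ok2 k j) Bkj ik nikj.
  have fV' : fr (g j V') by apply: frk; rewrite /V' gC (gC j k).
  have [_ b1] := lem V oV (sameR V) fV; have [b2 _] := lem V' oV' V'V fV'.
  by apply: (nrfr S b2); rewrite /V' gC (gC i k).
(* Then f_j V' is far, and all the maps send V near p. *)
- have kjj := on_centre (ok2 j j) Bjj ik c.
  have Bkj : B (g k (g j p)) by rewrite gC.
  set q := g k (g j p) in Bkj.
  have njq : ~ T (g j q) (P j).
    by rewrite /q gC => h; apply: (nk _ BPj); apply: sameT (sameS h) kjj.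
  have oq : ok q by exact: ok2.
  have iq := on_centre oq Bkj (nesym ij) njq; have kq := on_centre oq Bkj jk njq.
  have fV' : fr (g j V') by apply: frk; rewrite /V' gC (gC j k).
  have [b1 _] := lem V' oV' V'V fV'.
  have nkV : nr (g k V) by move: b1; rewrite /V' gC (gC i k).
  have njV : nr (g j V) by apply: (nrB _ (P i)) => //; rewrite /V gC (gC j i) gC.
  have niV : nr (g i V).
    have [l [hb hf]] := cross S oq oV Bkj (sameR V).
    case: (ix_cases l D) hb hf => -> hb hf.
    + by apply: hb; apply: near_same_sym iq.
    + by case: (nrfr S njV); apply: hf; rewrite /q gC; apply: sameT kjj PkV.
    + by case: (nrfr S nkV); apply: hf; apply: sameT kq PkV.
  have e1 : T (g j (g i (g i p))) (P j).
    apply: (on_centre (ok2 i i) Bii (nesym jk)) => h; apply: (nrfr S niV).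
    by apply: frk; rewrite /V gC.
  have e2 : T (g i (g i (g j p))) (P i).
    apply: (on_centre (ok2 i j) Bij (nesym ik)); apply: (nkT (P i)) => //.
    by rewrite gC.
  by apply: nij; apply: sameT (sameS e2) _; rewrite (gC i j) (gC i j).
Qed.

Lemma far_centre_distinct i j k : distinct3 i j k -> ~ T (P i) (P j) -> ~ B (P k) -> False.
Proof.
move=> D nij nB; have [ij ik jk] := D.
have [h|h] := commuting_square (ok1 i) (ok1 j) nij; last exact: far_centre_case D nij nB h.
by apply: (far_centre_case (And3 (nesym ij) jk ik)) h => // /sameS.
Qed.

(** The square (i, k) at w puts f_k w off at i or f_i w off at k. In the second
    case f_i w and its images by f_i and f_j are all at P_i, so f_k f_i w is
    not, and f_k w is off at i again. Likewise with j, but f_k w is off in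
    at most one coordinate. *)
Lemma two_equal_off w i j k : distinct3 i j k -> ok w -> (forall l, ok (g l w)) -> B w -> 
  (forall l, B (g l w)) ->
  T (P i) (P j) -> ~ T (P i) (P k) -> T (g i w) (P i) -> T (g j w) (P j) -> False.
Proof.
move=> D ow okw Bw Bgw Pij nik wi wj; have [ij ik jk] := D.
have njk : ~ T (P j) (P k) by move=> h; apply: nik; apply: sameT Pij h.
have key a b : distinct3 a b k -> T (P a) (P b) -> T (g a w) (P a) ->
    ~ T (g k (g a w)) (P k) -> ~ T (g a (g k w)) (P a).
  move=> Da Pab wa nka h; have [ab ak bk] := Da.
  have xa := on_centre (okw a) (Bgw a) (nesym ak) nka.
  have xb := on_centre (okw a) (Bgw a) (nesym bk) nka.
  apply: (not_moving (okw a) Da).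
  - exact: sameT wa (sameS xa).
  - by apply: sameT wa _; apply: sameT Pab _; exact: sameS.
  - by rewrite gC; apply: sameT wa (sameS h).
have ki := key i j D Pij wi.
have kj := key j i (And3 (nesym ij) jk ik) (sameS Pij) wj.
have [a|a] := commuting_square (okw i) (okw k) nik;
  have [b|b] := commuting_square (okw j) (okw k) njk.
- by case: (maj (okw k) (Bgw k) ij).
- by case: (maj (okw k) (Bgw k) ij) => // /(kj b).
- by case: (maj (okw k) (Bgw k) ij) => // /(ki a).
- by case: (maj (okw k) (Bgw k) ij); [apply: ki|apply: kj].
Qed.

(** The squares at p put f_k p off at i or f_i p off at k, and f_k p off at j or
    f_j p off at k. If f_i p is off at k, [two_equal_off] puts f_k p off at
    i; if f_j p is off at k, then f_k p is off at j because f_j p moves. In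
    all cases f_k p is off at both i and j. *)
Lemma near_centre_case i j k : distinct3 i j k -> B (P i) -> B (P k) ->
  T (P i) (P j) -> ~ T (P i) (P k) -> ~ T (g i p) (P i) -> False.
Proof.
move=> D BPi BPk Pij nik npi; have [ij ik jk] := D.
have njk : ~ T (P j) (P k) by move=> h; apply: nik; apply: sameT Pij h.
have pj := on_centre ok0 B0 ij npi; have pk := on_centre ok0 B0 ik npi.
have tj : ~ T (g k (g j p)) (P k) -> ~ T (g j (g k p)) (P j).
  move=> nkj h.
  have xi := on_centre (ok1 j) (B1 j) (nesym ik) nkj.
  have xj := on_centre (ok1 j) (B1 j) (nesym jk) nkj.
  apply: (not_moving (ok1 j) D).
  - by apply: sameT pj _; apply: sameT (sameS Pij) (sameS xi).
  - exact: sameT pj (sameS xj).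
  - by rewrite gC; apply: sameT pj (sameS h).
have nki : ~ T (g k (g i p)) (P k) -> T (g i (g k p)) (P i) -> False.
  move=> nki h.
  have xi := on_centre (ok1 i) (B1 i) (nesym ik) nki.
  have xj := on_centre (ok1 i) (B1 i) (nesym jk) nki.
  apply: (two_equal_off D (ok1 i) _ (B1 i) _ Pij nik xi xj) => // l.
  case: (ix_cases l D) => ->; first exact: near_same_sym BPi xi.
    by apply: near_same_sym xj; apply: BT BPi Pij.
  by rewrite gC; apply: near_same_sym BPi h.
have [a|a] := commuting_square (ok1 i) (ok1 k) nik;
  have [b|b] := commuting_square (ok1 j) (ok1 k) njk.
- by case: (maj (ok1 k) (B1 k) ij).
- by case: (maj (ok1 k) (B1 k) ij) => // /(tj b).
- by case: (maj (ok1 k) (B1 k) ij) => // /(nki a).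
- case: (maj (ok1 k) (B1 k) ij); [exact: nki a|exact: tj b].
Qed.

Lemma near_centre_two i j k : distinct3 i j k -> B (P i) -> B (P k) ->
  T (P i) (P j) -> ~ T (P i) (P k) -> False.
Proof.
move=> D BPi BPk Pij nik; have [ij ik jk] := D.
have [pi|] := pselect (T (g i p) (P i)); last exact: near_centre_case D BPi BPk Pij nik.
have [pj|] := pselect (T (g j p) (P j)).
  exact: (two_equal_off D ok0 ok1 B0 B1 Pij nik pi pj).
apply: (near_centre_case (And3 (nesym ij) jk ik) (BT BPi Pij) BPk (sameS Pij)) => h.
by apply: nik; apply: sameT Pij h.
Qed.

(** Every square w, f_i w, f_j w puts f_j w off at i or f_i w off at j; as each
    of f_1 w, f_2 w, f_3 w is off at most once, this is a cyclic orientation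
    of the three indices. In particular f_l f_l w is at P_l. For w = f_i p
    or w = f_k p this contradicts the orientation at f_j p. *)
Lemma near_centre_distinct i j k : distinct3 i j k -> (forall l, B (P l)) ->
  ~ T (P i) (P j) -> ~ T (P i) (P k) -> ~ T (P j) (P k) -> False.
Proof.
move=> D BP.
have tour i' j' k' w : distinct3 i' j' k' ->
    ~ T (P i') (P j') -> ~ T (P i') (P k') -> ~ T (P j') (P k') ->
    ok w -> (forall l, ok (g l w)) -> B w -> (forall l, B (g l w)) ->
    ~ T (g i' (g j' w)) (P i') -> 
    [/\ ~ T (g j' (g k' w)) (P j'), ~ T (g k' (g i' w)) (P k') & forall l, T (g l (g l w)) (P l)].
  move=> [ij ik jk] nij nik njk ow okw Bw Bgw h.
  have xk := on_centre (okw j') (Bgw j') ik h.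
  have c1 : ~ T (g j' (g k' w)) (P j').
    by have [//|] := commuting_square (okw j') (okw k') njk.
  have xi := on_centre (okw k') (Bgw k') (nesym ij) c1.
  have c2 : ~ T (g k' (g i' w)) (P k').
    by have [|//] := commuting_square (okw i') (okw k') nik.
  split=> // l; case: (ix_cases l (And3 ij ik jk)) => ->.
  - exact: on_centre (okw i') (Bgw i') (nesym ik) c2.
  - exact: on_centre (okw j') (Bgw j') ij h.
  - exact: on_centre (okw k') (Bgw k') jk c1.
move=> nij nik njk; have [ij ik jk] := D.
wlog h : i j D nij nik njk ij ik jk / ~ T (g i (g j p)) (P i).
  move=> W; have [h|h] := commuting_square (ok1 i) (ok1 j) nij; first exact: (W i j).
  apply: (W j i) h => //; [exact: (And3 (nesym ij) jk ik)|by move/sameS|exact: nesym].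
have [h2 h3 _] := tour i j k p D nij nik njk ok0 ok1 B0 B1 h.
have nji : ~ T (P j) (P i) by move/sameS.
have on2 l m : l <> m -> ~ T (g l (g m p)) (P l) -> forall n, n <> l -> T (g n (g m p)) (P n).
  by move=> lm hl n nl; exact: on_centre (ok1 m) (B1 m) (nesym nl) hl.
have B2 m l : B (g l (g m p)).
  have near x a : T x (P a) -> B x by move=> h'; apply: near_same_sym (BP a) h'.
  case: (ix_cases m D) => ->.
  - have [->|lk] := pselect (l = k); last exact: near (on2 k i (nesym ik) h3 l lk).
    by rewrite gC; apply: near (on2 j k jk h2 i ij).
  - have [->|li] := pselect (l = i); last exact: near (on2 i j ij h l li).
    by rewrite gC; apply: near (on2 k i (nesym ik) h3 j jk).
  - have [->|lj] := pselect (l = j); last exact: near (on2 j k jk h2 l lj).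
    by rewrite gC; apply: near (on2 i j ij h k (nesym ik)).
have tl m : forall l, T (g l (g l (g m p))) (P l).
  have [h'|h'] := commuting_square (ok2 i m) (ok2 j m) nij.
    by have [_ _] := tour i j k (g m p) D nij nik njk (ok1 m) (ok2^~ m) (B1 m) (B2 m) h'.
  have D' : distinct3 j i k by split=> //; exact: nesym.
  by have [_ _] := tour j i k (g m p) D' nji njk nik (ok1 m) (ok2^~ m) (B1 m) (B2 m) h'.
have [h'|h'] := commuting_square (ok2 i j) (ok2 j j) nij.
  have [c _ _] := tour i j k (g j p) D nij nik njk (ok1 j) (ok2^~ j) (B1 j) (B2 j) h'.
  by apply: c; rewrite (gC k j); exact: tl.
by apply: h'; rewrite (gC i j); exact: tl.
Qed.

(** At p at most one coordinate is off, so two of the P_i are near p. *)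
Theorem majority_centre : forall i j, T (P i) (P j).
Proof.
have [allB|] := pselect (forall l, B (P l)).
- have pair i j k : distinct3 i j k -> T (P i) (P j) -> T (P i) (P k).
    by move=> D e; apply: contrapT => n; apply: near_centre_two D (allB i) (allB k) e n.
  have any i j k : distinct3 i j k -> T (P i) (P j).
    move=> D; have [ij ik jk] := D; apply: contrapT => nij.
    have [e|nik] := pselect (T (P i) (P k)).
      by apply: nij; apply: (pair i k j (And3 ik ij (nesym jk))).
    have [e|njk] := pselect (T (P j) (P k)).
      by apply: nij; apply/sameS; apply: (pair j k i (And3 jk (nesym ij) (nesym ik))).
    exact: near_centre_distinct D allB nij nik njk.
  move=> i j; have [->|ij] := pselect (i = j); first exact: sameR.
  by have [k D] := ix_third ij; apply: any D.
- move=> /existsNP[k nB] a0 b0; exfalso.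
  have [a [b [ka kb ab]]] := ix_other k.
  have D : distinct3 a b k by split=> //; exact: nesym.
  have [e|n] := pselect (T (P a) (P b)); first exact: far_centre_equal D e nB.
  exact: far_centre_distinct D n nB.
Qed.
End Majority.

(** ** The binary case *)

(** The i-th coordinate takes the two values f_i p and [y i]; [lab w i] tells
    which one f_i w has. *)
Section Fano.
Variable y : ix -> X.
Let v i (b : bool) := if b then y i else g i p.
Hypothesis ne : forall i, ~ T (g i p) (y i).
Variable lab : X -> ix -> bool.
Hypothesis labP : forall w i, ok w -> B w -> T (g i w) (v i (lab w i)).
Hypothesis class_parity : forall w i j k, ok w -> B w -> distinct3 i j k -> lab w i = lab w j (+) lab w k.

Lemma letter_unique i b b' : T (v i b) (v i b') -> b = b'.
Proof. by case: b b' => -[] //= => [/sameS|] /ne. Qed.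

Lemma near_lab w i : ok w -> B w -> ~ B (y i) -> B (g i w) -> lab w i = false.
Proof.
move=> ow Bw nB Bi; have := labP i ow Bw; case: (lab w i) => // h.
by case: nB; apply: BT Bi h.
Qed.

Lemma lab_near w i : ok w -> B w -> B (y i) \/ lab w i = false -> B (g i w).
Proof.
move=> ow Bw h; apply: (near_same_sym (x := v i (lab w i))); last exact: labP.
by case: (lab w i) h => [[]//|_]; exact: B1.
Qed.

(** The basic constraint: f_i f_j w is described by the labels of f_j w and by
    those of f_i w. *)
Lemma lab_square w i j : ok (g i w) -> ok (g j w) -> B (g i w) -> B (g j w) ->
  T (v i (lab (g j w) i)) (v j (lab (g i w) j)).
Proof.
move=> oi oj Bi Bj; apply: sameT (sameS (labP i oj Bj)) _.
by rewrite gC; apply: labP.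
Qed.

(** The six values fall into two classes, each containing one value of every
    coordinate. *)
Definition two_valued := exists s : ix -> bool,
  forall i j b b', s i (+) b = s j (+) b' -> T (v i b) (v j b').

(** For i <> j, let M_ij be the partial matching between the two values of
    coordinate i and the two values of coordinate j that are at the same
    place. By [lab_square] it is not empty. If it is complete ([dbl]) for
    two pairs of indices, there are two classes. Otherwise two pairs (i, k),
    (j, k) are matched only once; this fixes the labels of all points f_k w,
    and f_k f_i p is not moved. *)
Lemma all_near : (forall i, B (y i)) -> two_valued.
Proof.
move=> By; have Bv i b : B (v i b) by case: b => /=; [exact: By|exact: B1].
have B2 i j : B (g i (g j p)) by apply: lab_near; [exact: ok1|exact: B1|left].
pose dbl i j := exists s, forall b, T (v i b) (v j (b (+) s)).
have dblS i j : dbl i j -> dbl j i.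
  by move=> [s h]; exists s => b; apply: sameS; have := h (b (+) s); rewrite -addbA addbb addbF.
have two i j k : distinct3 i j k -> dbl i j -> dbl i k -> two_valued.
  move=> D [s hs] [t ht]; have [ij ik jk] := D.
  have hasI l : exists r, forall b, T (v i b) (v l (b (+) r)).
    by case: (ix_cases l D) => ->; [exists false => b; rewrite addbF; exact: sameR|exists s|exists t].
  have [r hr] := choice hasI; exists r => a c b b' e.
  have hr' l d : T (v i (d (+) r l)) (v l d) by have := hr l (d (+) r l); rewrite -addbA addbb addbF.
  apply: sameT (sameS (hr' a b)) _; rewrite addbC e addbC; exact: hr'.
have single i j : i <> j -> ~ dbl i j -> exists a b, T (v i a) (v j b) /\
    forall w, ok (g i w) -> ok (g j w) -> B (g i w) -> B (g j w) -> 
      lab (g j w) i = a /\ lab (g i w) j = b.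
  move=> ij nd; have h0 := lab_square (ok1 i) (ok1 j) (B1 i) (B1 j).
  exists (lab (g j p) i), (lab (g i p) j); split=> // w oi oj Bi Bj.
  have h1 := lab_square oi oj Bi Bj.
  set a := lab (g j p) i in h0 *; set b := lab (g i p) j in h0 *.
  move: h1; set c := lab (g j w) i; set d := lab (g i w) j => h1.
  have [e|ac] := eqVneq c a.
    by rewrite e in h1 *; split=> //; apply: (@letter_unique j); apply: sameT (sameS h1) h0.
  have [e|bd] := eqVneq d b.
    by rewrite e in h1; case/eqP: ac; apply: (@letter_unique i); apply: sameT h1 (sameS h0).
  case: nd; exists (a (+) b) => x; move: ac bd h0 h1.
  by case: (a) (b) (c) (d) x => -[] [] [] [].
have bad i j k : distinct3 i j k -> ~ dbl i k -> ~ dbl j k -> False.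
  move=> D n1 n2; have [ij ik jk] := D.
  have [a1 [a3 [t13 h13]]] := single i k ik n1.
  have [a2 [a3' [t23 h23]]] := single j k jk n2.
  have label_parity_shallow w : ok w -> B w -> lab w k = lab w i (+) lab w j.
    by move=> ow Bw; apply: class_parity => //; split=> //; exact: nesym.
  have [e1 e2] := h13 p (ok1 i) (ok1 k) (B1 i) (B1 k).
  have [e3 e4] := h23 p (ok1 j) (ok1 k) (B1 j) (B1 k).
  have [e5 e6] := h13 (g k p) (ok2 i k) (ok2 k k) (B2 i k) (B2 k k).
  have [e7 e8] := h23 (g k p) (ok2 j k) (ok2 k k) (B2 j k) (B2 k k).
  have [e9 _] := h13 (g i p) (ok2 i i) (ok2 k i) (B2 i i) (B2 k i).
  have [e10 _] := h23 (g i p) (ok2 j i) (ok2 k i) (B2 j i) (B2 k i).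
  have [e11 _] := h13 (g j p) (ok2 i j) (ok2 k j) (B2 i j) (B2 k j).
  have [e12 _] := h23 (g j p) (ok2 j j) (ok2 k j) (B2 j j) (B2 k j).
  have E1 : a3 = a1 (+) a2 by rewrite -e6 gC label_parity_shallow ?e9 ?e10.
  have E2 : a3' = a1 (+) a2 by rewrite -e8 gC label_parity_shallow ?e11 ?e12.
  have E : a3' = a3 by rewrite E1 E2.
  rewrite {}E in t23.
  have ox := ok2 k i; have Bx := B2 k i.
  have x3 : T (g k (g i p)) (v k a3) by rewrite -e2; apply: labP; [exact: ok1|exact: B1].
  have to3 l c : lab (g k (g i p)) l = c -> T (v l c) (v k a3) ->
      T (g k (g i p)) (g l (g k (g i p))).
    by move=> <- h; apply: sameT x3 (sameS _); apply: sameT (labP _ ox Bx) h.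
  apply: (not_moving ox D); [exact: to3 e9 t13|exact: to3 e10 t23|].
  by apply: (to3 k a3); [rewrite label_parity_shallow // e9 e10 -E1|exact: sameR].
have D123 : distinct3 I1 I2 I3 by [].
have [d12|n12] := pselect (dbl I1 I2).
  have [d13|n13] := pselect (dbl I1 I3); first exact: two D123 d12 d13.
  have [d23|n23] := pselect (dbl I2 I3); last by case: (bad I1 I2 I3).
  by apply: (two I2 I1 I3) => //; exact: dblS.
have [d13|n13] := pselect (dbl I1 I3); last by case: (bad I2 I3 I1) => // /dblS.
have [d23|n23] := pselect (dbl I2 I3); last by case: (bad I1 I3 I2) => // /dblS.
by apply: (two I3 I1 I2) => //; exact: dblS.
Qed.

(** For a <> k, if f_k w is near then so is f_k f_a w = f_a f_k w, which is then
    at f_k p. So f_k p, and f_k f_a p as well, is kept in place by the two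
    other maps and has to be sent by f_k to the far value. Therefore Z = f_k
    f_k p is at the far value, together with f_i Z and f_j Z. At the larger
    scale f_k Z must be near, because of p, and far, because of f_k p. *)
Lemma one_far i j k : distinct3 i j k -> B (y i) -> B (y j) -> ~ B (y k) -> False.
Proof.
move=> D Bi Bj nB; have [ij ik jk] := D.
have Ba l : l <> k -> B (y l) by case: (ix_cases l D) => ->.
have same a w : a <> k -> ok w -> B w -> ok (g a w) -> ok (g k w) -> B (g k w) -> 
    T (g a (g k w)) (g k p) /\ B (g k (g a w)).
  move=> ak ow Bw oa okk Bk.
  have Bak : B (g k (g a w)) by rewrite gC; apply: lab_near => //; left; exact: Ba.
  have Baw : B (g a w) by apply: lab_near => //; left; exact: Ba.
  split=> //; rewrite gC; have := labP k oa Baw.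
  by rewrite near_lab.
have turn w : ok w -> B w -> (forall l, ok (g l w)) -> ok (g k w) -> B (g k w) -> 
    T (g k w) (g k p) -> T (g k (g k w)) (y k).
  move=> ow Bw ol okk Bk e.
  have [hi _] := same i w ik ow Bw (ol i) okk Bk.
  have [hj _] := same j w jk ow Bw (ol j) okk Bk.
  have := labP k okk Bk; case: (lab _ _) => // h; exfalso.
  by apply: (not_moving okk D); apply: sameT e (sameS _).
have Z0 := turn p ok0 B0 ok1 (ok1 k) (B1 k) (sameR _).
set Z := g k (g k p) in Z0.
have Z1 a : a <> k -> T (g a Z) Z.
  move=> ak; have [h1 h2] := same a p ak ok0 B0 (ok1 a) (ok1 k) (B1 k).
  apply: sameT (sameS Z0); rewrite /Z gC (gC a k); apply: (turn (g a p)) => //.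
  by rewrite -gC.
have nBZ : ~ B Z by move=> h; apply: nB; apply: BT h Z0.
have [nr [fr S]] := far_scales L (ok1 k) nBZ.
have oZ : ok Z by exact: ok2.
have nZ a : a <> k -> ~ nr (g a Z).
  by move=> ak h; apply: (nrfr S h); apply: (Zfr S); exact: Z1.
have c1 : nr (g k Z).
  have [l [hb _]] := cross S ok0 oZ B0 (sameR Z); have {}hb := hb (B1 l).
  by case: (ix_cases l D) hb => -> // /nZ; case.
apply: (nrfr S c1).
have [l [hb hf]] := cross S (ok1 k) oZ (B1 k) (sameR Z).
have [lk|lk] := pselect (l = k); first by rewrite lk in hf; apply: hf; exact: sameR.
case: (nZ l lk); apply: hb.
by have [_] := same l p lk ok0 B0 (ok1 l) (ok1 k) (B1 k); rewrite gC.
Qed.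

(** The labels of f_i p vanish, since f_j f_i p = f_i f_j p and f_k f_i p = f_i
    f_k p are near. The values f_j p and f_k p are among f_i p and [y i].
    They are not both f_i p, as f_i p moves; if only one of them is,
    comparing Z = f_a f_b p and Z' = f_b f_b p with p, f_a p, f_b p at the
    larger scale gives incompatible places for f_a Z' = f_b Z. *)
Lemma two_far i j k : distinct3 i j k -> B (y i) -> ~ B (y j) -> ~ B (y k) ->
  T (g j p) (g k p) /\ T (g j p) (y i).
Proof.
move=> D By nj nk; have [ij ik jk] := D.
have D' : distinct3 i k j by split=> //; exact: nesym.
have Bi w : ok w -> B w -> B (g i w) by move=> ow Bw; apply: lab_near => //; left.
have far c : c <> i -> ~ B (y c) by case: (ix_cases c D) => ->.
have st w : ok w -> B w -> (forall l, ok (g l w)) -> (forall l, B (g l w)) ->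
    (forall l, lab (g i w) l = false) /\ forall c, c <> i -> T (g c p) (v i (lab (g c w) i)).
  move=> ow Bw ol Bl.
  have lc c : c <> i -> lab (g i w) c = false.
    by move=> ci; apply: near_lab => //; [exact: far|rewrite gC; exact: Bi].
  split=> [l|c ci].
    case: (ix_cases l D) => ->; [|exact/lc/nesym|exact/lc/nesym].
    by rewrite (class_parity (ol i) (Bl i) D) !lc //; exact: nesym.
  by have := lab_square (ol i) (ol c) (Bl i) (Bl c); rewrite lc //; move/sameS.
have [l0 s0] := st p ok0 B0 ok1 B1.
have B2 l : B (g l (g i p)) by apply: lab_near => //; right.
have [_ s1] := st (g i p) (ok1 i) (B1 i) (ok2^~ i) B2.
have bad a b : distinct3 i a b -> T (g a p) (y i) -> T (g b p) (g i p) -> False.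
  move=> Dab ai bi; have [ia ib ab] := Dab.
  have na := far a (nesym ia); have nb := far b (nesym ib).
  have labs w : ok w -> B w -> (forall l, ok (g l w)) -> (forall l, B (g l w)) ->
      [/\ lab (g b w) a, lab (g b w) b & lab (g a w) b].
    move=> ow Bw ol Bl; have [_ sc] := st w ow Bw ol Bl.
    have e1 : lab (g a w) i = true.
      by apply: (@letter_unique i); apply: sameT (sameS (sc a (nesym ia))) ai.
    have e2 : lab (g b w) i = false.
      by apply: (@letter_unique i); apply: sameT (sameS (sc b (nesym ib))) bi.
    have := class_parity (ol b) (Bl b) Dab; rewrite e2.
    have := lab_square (ol a) (ol b) (Bl a) (Bl b).
    case: (lab (g b w) a); case: (lab (g a w) b); case: (lab (g b w) b) => //= h _.
    - by case: na; apply: near_same_sym (B1 b) h.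
    - by case: nb; apply: BT (B1 a) h.
    - by case: (ne (i := i)); apply: sameT (sameS bi) (sameT (sameS h) ai).
  have [c1 c2 c3] := labs p ok0 B0 ok1 B1.
  have [d1 d2 d3] := labs (g i p) (ok1 i) (B1 i) (ok2^~ i) B2.
  have Za : T (g a (g b p)) (y a) by have := labP a (ok1 b) (B1 b); rewrite c1.
  have Zb : T (g a (g b p)) (y b) by have := labP b (ok1 a) (B1 a); rewrite c3 gC.
  have Z'b : T (g b (g b p)) (y b) by have := labP b (ok1 b) (B1 b); rewrite c2.
  set Z := g a (g b p) in Za Zb; set Z' := g b (g b p) in Z'b.
  have iZ : T (g i Z) Z.
    by apply: sameT (sameS Za); have := labP a (ok2 b i) (B2 b); rewrite d1 /Z (gC i a) (gC i b p).
  have iZ' : T (g i Z') Z.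
    by apply: sameT (sameS Zb); have := labP b (ok2 b i) (B2 b); rewrite d2 /Z' (gC i b (g b p)) (gC i b p).
  have nBZ : ~ B Z by move=> h; apply: na; apply: BT h Za.
  have [nr [fr S]] := far_scales L (ok1 b) nBZ.
  have lem W : ok W -> T W Z -> T (g i W) Z -> nr (g a W) /\ fr (g b W).
    move=> oW WZ iW; have nf := nrfr S.
    have ni : ~ nr (g i W) by move=> h; apply: (nf _ h); apply: (Zfr S).
    have a1 : nr (g a W) \/ nr (g b W).
      have [l [h _]] := cross S ok0 oW B0 WZ; have {}h := h (B1 l).
      by case: (ix_cases l Dab) h => -> h; [|left|right].
    have a2 : fr (g a W) \/ fr (g b W).
      have [l [hb hf]] := cross S (ok1 b) oW (B1 b) WZ.
      case: (ix_cases l Dab) hb hf => -> hb hf.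
      - by case: ni; apply: hb; rewrite gC.
      - by left; apply: hf; exact: sameR.
      - by right; apply: hf; apply: sameT Z'b (sameS Zb).
    have a3 : nr (g a W) \/ fr (g b W).
      have [l [hb hf]] := cross S (ok1 a) oW (B1 a) WZ.
      case: (ix_cases l Dab) hb hf => -> hb hf.
      - by case: ni; apply: hb; rewrite gC.
      - left; apply: hb; apply: lab_near => //; right.
        have := class_parity (ok1 a) (B1 a) Dab; rewrite c3.
        have -> : lab (g a p) i = true by apply: (@letter_unique i); apply: sameT (sameS (s0 a (nesym ia))) ai.
        by case: (lab (g a p) a).
      - by right; apply: hf; rewrite gC; exact: sameR.
    case: a1 => a1; first by split=> //; case: a2 => // /(nf _ a1).
    by case: a3 => [a3|/(nf _ a1) //]; split=> //; case: a2 => // /(nf _ a3).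
  have [_ h1] := lem Z (ok2 a b) (sameR _) iZ.
  have [h2 _] := lem Z' (ok2 b b) (sameT Z'b (sameS Zb)) iZ'.
  by apply: (nrfr S h2); rewrite /Z' (gC a b (g b p)).
have sj := s0 j (nesym ij); have sk := s0 k (nesym ik).
have [h1|h1] := boolP (lab (g j p) i); have [h2|h2] := boolP (lab (g k p) i).
- by rewrite h1 in sj; rewrite h2 in sk; split=> //; apply: sameT sj (sameS sk).
- exfalso; rewrite h1 in sj; rewrite (negbTE h2) in sk; exact: bad D sj sk.
- exfalso; rewrite (negbTE h1) in sj; rewrite h2 in sk; exact: bad D' sk sj.
- exfalso; rewrite (negbTE h1) in sj; rewrite (negbTE h2) in sk.
  apply: (not_moving (ok1 i) D).
  + by have := labP i (ok1 i) (B1 i); rewrite l0; move/sameS.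
  + by have := labP j (ok1 i) (B1 i); rewrite l0 => h; apply: sameS; apply: sameT h sj.
  + by have := labP k (ok1 i) (B1 i); rewrite l0 => h; apply: sameS; apply: sameT h sk.
Qed.

(** If label i of f_j p and of f_k p vanished, f_i p would not move; and if one
    of them does not vanish, [lab_square] identifies two far values. *)
Lemma all_far : (forall i, ~ B (y i)) -> forall i j, T (y i) (y j).
Proof.
move=> nB.
have sq i j : lab (g j p) i = lab (g i p) j.
  have := lab_square (ok1 i) (ok1 j) (B1 i) (B1 j).
  case: (lab (g j p) i); case: (lab (g i p) j) => //= h.
    by case: (nB i); apply: near_same_sym (B1 j) h.
  by case: (nB j); apply: BT (B1 i) h.
have eqy i j : lab (g j p) i -> T (y i) (y j).
  by move=> h; have := lab_square (ok1 i) (ok1 j) (B1 i) (B1 j); rewrite -(sq i j) h.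
have some i j k : distinct3 i j k -> T (y i) (y j) \/ T (y i) (y k).
  move=> D; have [h|h1] := boolP (lab (g j p) i); first by left; exact: eqy.
  have [h|h2] := boolP (lab (g k p) i); first by right; exact: eqy.
  exfalso; have l1 := h1; have l2 := h2; rewrite sq in l1; rewrite sq in l2.
  have l3 : lab (g i p) i = false.
    by rewrite (class_parity (ok1 i) (B1 i) D) (negbTE l1) (negbTE l2).
  have := lab_square (ok1 i) (ok1 j) (B1 i) (B1 j).
  rewrite (negbTE h1) (negbTE l1) => eij.
  have := lab_square (ok1 i) (ok1 k) (B1 i) (B1 k).
  rewrite (negbTE h2) (negbTE l2) => eik.
  apply: (not_moving (ok1 i) D).
  + by have := labP i (ok1 i) (B1 i); rewrite l3; move/sameS.
  + have := labP j (ok1 i) (B1 i); rewrite (negbTE l1) => h; exact: sameT eij (sameS h).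
  + have := labP k (ok1 i) (B1 i); rewrite (negbTE l2) => h; exact: sameT eik (sameS h).
move=> i j; have [->|ij] := pselect (i = j); first exact: sameR.
have [k D] := ix_third ij; have [_ ik jk] := D.
have [//|e1] := some i j k D.
have [|e2] := some j i k (And3 (nesym ij) jk ik); first exact: sameS.
exact: sameT e1 (sameS e2).
Qed.
End Fano.
End Local.

(** * Two clusters *)

Definition eq_ix (i j : ix) : bool :=
  match i, j with I1, I1 | I2, I2 | I3, I3 => true | _, _ => false end.

Lemma eq_ixP i j : reflect (i = j) (eq_ix i j).
Proof. by case: i j => -[]; constructor. Qed.

(** The four even words of length three: [None] is 000 and [Some k] has its only
    0 at k. *)
Definition even_word (t : option ix) (l : ix) : bool := if t is Some k then ~~ eq_ix l k else false.

Lemma even_word_self k : even_word (Some k) k = false. Proof. by case: k. Qed.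
Lemma even_word_other k l : l <> k -> even_word (Some k) l = true. Proof. by move=> /eq_ixP. Qed.

Section Clusters.
Variables (R : realType) (X : Type) (d : X -> X -> R) (g : ix -> X -> X) (lam : R).
Hypothesis sys : system d g lam.
Let dge0 := dge0 sys.
Let dsym := dsym sys.
Let dtri := dtri sys.
Let gC := gC sys.
Notation Orb := (in_orbit g).
Notation contr := (contracts d g lam).

Variables (p0 : X) (chi : X -> bool) (M : R).
Notation O := (Orb p0).

(** [chi] is the cluster. A map contracting a pair in one cluster sends it into
    one cluster, because clusters are small with respect to their distance. *)
Record two_clusters : Prop := TwoClusters {
  class_parity : forall x i j k, O x -> distinct3 i j k -> chi (g i x) = chi (g j x) (+) chi (g k x);
  contracted_class : forall x y i, O x -> O y -> chi x = chi y -> contr i x y -> chi (g i x) = chi (g i y);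
  class_bounded : forall x y, O x -> O y -> chi x = chi y -> d x y <= M }.

(** The clusters of f_1 x, f_2 x, f_3 x form an even word. *)
Definition has_type (t : option ix) (x : X) := forall l, chi (g l x) = even_word t l.

Hypothesis TC : two_clusters.
Let class_parity := class_parity TC.
Let contracted_class := contracted_class TC.

Lemma orbit_closed i x : O x -> O (g i x). Proof. exact: orb_step. Qed.
Hint Resolve orbit_closed : core.

Lemma type_two_ones i j k x : O x -> distinct3 i j k -> chi (g i x) -> chi (g j x) -> has_type (Some k) x.
Proof.
move=> Ox D ci cj l; have [ij ik jk] := D.
case: (ix_cases l D) => ->; [by rewrite even_word_other|by rewrite even_word_other|].
by rewrite (class_parity Ox (And3 (nesym ik) (nesym jk) ij)) ci cj even_word_self.
Qed.

Lemma type_two_zeros i j k x : O x -> distinct3 i j k -> ~~ chi (g i x) -> ~~ chi (g j x) -> has_type None x.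
Proof.
move=> Ox D /negbTE ci /negbTE cj l; have [ij ik jk] := D.
case: (ix_cases l D) => -> //.
by rewrite (class_parity Ox (And3 (nesym ik) (nesym jk) ij)) ci cj.
Qed.

Lemma type_one_zero i j k x : O x -> distinct3 i j k -> chi (g i x) -> ~~ chi (g j x) -> has_type (Some j) x.
Proof.
move=> Ox D ci cj; have [ij ik jk] := D.
apply: (@type_two_ones i k) => //; first by split=> //; exact: nesym.
by rewrite (class_parity Ox (And3 (nesym ik) (nesym jk) ij)) ci (negbTE cj).
Qed.

Lemma type_exists x : O x -> exists t, has_type t x.
Proof.
move=> Ox; have D : distinct3 I1 I2 I3 by [].
have [c1|c1] := boolP (chi (g I1 x)); have [c2|c2] := boolP (chi (g I2 x)).
- by exists (Some I3); apply: type_two_ones c1 c2.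
- by exists (Some I2); apply: type_one_zero D _ _.
- by exists (Some I1); apply: (@type_one_zero I2 I1 I3).
- by exists None; apply: type_two_zeros D _ _.
Qed.

Lemma type_self k x : has_type (Some k) x -> ~~ chi (g k x).
Proof. by move=> h; rewrite h even_word_self. Qed.
Lemma type_other k l x : has_type (Some k) x -> l <> k -> chi (g l x).
Proof. by move=> h lk; rewrite h even_word_other. Qed.

(** Distinct even words agree in exactly one coordinate. *)
Lemma contr_agree i x u : O x -> O u -> chi x = chi u -> chi (g i x) = chi (g i u) ->
  (exists l, chi (g l x) <> chi (g l u)) -> contr i x u.
Proof.
move=> Ox Ou e ei [l nl]; have [m hm] := contractive sys x u.
have em := contracted_class Ox Ou e hm.
have [<-//|mi] := pselect (m = i).
have [k D] := ix_third mi; have [_ mk ik] := D; case: nl.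
case: (ix_cases l D) => -> //.
have D' : distinct3 k m i by split=> //; exact: nesym.
by rewrite (class_parity Ox D') (class_parity Ou D') em ei.
Qed.

(** Along such a line z_n, the points f_i z_n and f_j z_n stay in cluster 1,
    with different types among i and j: opposite lines. *)
Lemma no_constant_line z i j k : O z -> distinct3 i j k ->
  (forall n, ~~ chi (iter n (g k) z) /\ has_type (Some k) (iter n (g k) z)) -> False.
Proof.
move=> Oz D h; have [ij ik jk] := D.
have Oi n : O (iter n (g k) z) by elim: n => //= n IH; apply: orbit_closed.
have comm a n : iter n (g k) (g a z) = g a (iter n (g k) z).
  by elim: n => //= n ->; rewrite gC.
have one a n : a <> k -> chi (iter n (g k) (g a z)).
  by move=> ak; rewrite comm; apply: type_other ak; have [_] := h n.
pose s n := chi (g i (g j (iter n (g k) z))).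
have Oa a n : O (iter n (g k) (g a z)) by rewrite comm; apply: orbit_closed.
have ck a n : a <> k -> chi (g k (iter n (g k) (g a z))) by move=> ak; exact: (one a n.+1).
have cj n : chi (g j (iter n (g k) (g i z))) = s n by rewrite comm gC.
have ci n : chi (g i (iter n (g k) (g j z))) = s n by rewrite comm.
apply: (opposite_lines sys (i := k) (z := g i z) (z' := g j z) (s := s)) => n m.
  move=> /eqP nm; apply: contr_agree; rewrite ?one ?ck //.
  by exists j; rewrite !cj.
move=> nm; apply: contr_agree; rewrite ?one ?ck //.
exists j; rewrite cj (class_parity (Oa j m) (And3 (nesym ij) jk ik)) ci ck // nm.
by case: (s m).
Qed.

Definition occurs y (st : bool * option ix) := exists z, [/\ Orb y z, chi z = st.1 & has_type st.2 z].

(** [NC]: no sub-orbit stays in cluster 0. [TERM]: if type 000 occurs in cluster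
    1 of a sub-orbit, this sub-orbit has a point of type 000 none of whose
    images has type 000. [H2]: cluster 1 of a sub-orbit does not consist of
    points of type 000. *)
Hypothesis NC : forall y, O y -> exists2 z, Orb y z & chi z.
Hypothesis TERM : forall y, O y -> (exists z, [/\ Orb y z, chi z & has_type None z]) ->
  exists z, [/\ Orb y z, has_type None z & forall i, ~ has_type None (g i z)].
Hypothesis H2 : forall y, O y -> ~ (forall z, Orb y z -> chi z -> has_type None z).

(** From now on [y0] is a point such that no pair (cluster, type) occurring in
    its orbit is missing in a sub-orbit; [V s t] means that type t occurs in
    cluster s. *)
Section Stable.
Variable y0 : X.
Hypothesis Oy0 : O y0.
Hypothesis stab : forall st z, Orb y0 z -> occurs y0 st -> occurs z st.
Let V s t := occurs y0 (s, t).

Lemma stable_orbit x : Orb y0 x -> O x. Proof. exact: orb_trans. Qed.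

Lemma occurs_here z t : Orb y0 z -> has_type t z -> V (chi z) t.
Proof. by move=> oz tz; exists z. Qed.

(** Otherwise every point of cluster 1 has exactly one image in cluster 0, and
    [constant_exit] gives x and k such that the points reached from x
    without f_k are in cluster 1 with type k. By parity the orbit of f_k x
    is then in cluster 0. *)
Lemma no_missing_none : V true None.
Proof.
apply: contrapT => nV.
have hm z : exists k, Orb y0 z -> chi z -> has_type (Some k) z.
  have [[oz cz]|n] := pselect (Orb y0 z /\ chi z); last by exists I1 => a b; case: n.
  have [[k|] tz] := type_exists (stable_orbit oz); first by exists k.
  by case: nV; rewrite -cz; apply: occurs_here.
have [m Hm] := choice hm.
pose P z := Orb y0 z /\ chi z.
have mT z l : P z -> chi (g l z) = ~~ eq_ix l (m z) by move=> [oz cz]; apply: (Hm z oz cz).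
have [z oz cz] := NC Oy0.
have hP x : P x -> forall i, P (g i x) <-> i <> m x.
  move=> Px i; split=> [[_]|im]; first by rewrite mT // => /eq_ixP.
  by split; [case: Px => ox _; apply: orb_step|rewrite mT//; apply/eq_ixP].
have hc x u : P x -> P u -> m x <> m u -> ~ contr (m x) x u.
  move=> Px Pu ne /(contracted_class (stable_orbit Px.1) (stable_orbit Pu.1)); rewrite Px.2 Pu.2 => /(_ erefl).
  by rewrite !mT //; case: eq_ixP => // _; case: eq_ixP.
have hM x u : P x -> P u -> d x u <= M.
  by move=> [ox cx] [ou cu]; apply: (class_bounded TC); rewrite ?cx ?cu //; exact: stable_orbit.
have [x [k [_ Px hw]]] := constant_exit sys hP hc hM (conj oz cz).
have comm a n w : iter n (g k) (g a w) = g a (iter n (g k) w).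
  by elim: n => //= n ->; rewrite gC.
have dec y : Orb x y -> exists n w, walk g m x w /\ y = iter n (g k) w.
  move: y; apply: orb_ind => [|i y _ [n [w [xw ->]]]]; first by exists 0%N, x; split=> //; exact: walk0.
  have [->|ik] := pselect (i = k); first by exists n.+1, w.
  by exists n, (g i w); rewrite comm; split=> //; apply: walkS; rewrite ?hw.
have cl n : forall w, walk g m x w -> chi (g k (iter n (g k) w)) = false.
  elim: n => [|n IH] w xw.
    by rewrite mT ?hw //; [case: eq_ixP|exact: walkP hP _ _ Px xw].
  have [i [j D]] := ix_other k; have [ki kj ij] := D.
  have Oy : O (iter n.+1 (g k) w).
    have oxw := walk_orb xw; elim: (n.+1) => [|n' IH'] /=; last exact: orbit_closed.
    by apply: orb_trans oxw; apply: stable_orbit; case: Px.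
  rewrite (class_parity Oy D) /= (gC i k) (gC j k) -(comm i) -(comm j).
  by rewrite !IH //; apply: walkS; rewrite ?hw //; exact: nesym.
have [|t ot ct] := NC (y := g k x); first by apply: orbit_closed; apply: stable_orbit; case: Px.
have [y oy ey] := orb_image sys ot; have [n [w [xw ew]]] := dec y oy.
by move: ct; rewrite ey ew cl.
Qed.

Lemma terminal y : Orb y0 y -> exists z, [/\ Orb y z, has_type None z & forall i, ~ has_type None (g i z)].
Proof.
move=> oy; apply: TERM; first exact: stable_orbit.
by have [z [oz cz tz]] := stab oy no_missing_none; exists z.
Qed.

(** f_i z is in cluster 0 and not of type 000. *)
Lemma terminal_row z i j k : O z -> has_type None z -> ~ has_type None (g i z) -> distinct3 i j k ->
  chi (g i (g j z)) \/ chi (g i (g k z)).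
Proof.
move=> Oz Nz nN D; have [ij ik jk] := D.
apply: contrapT => /not_orP[/negP a /negP b]; apply: nN.
by apply: (@type_two_zeros j k i); rewrite ?(gC j) ?(gC k) //; [exact: orbit_closed|split=> //; exact: nesym].
Qed.

(** Let z be terminal of type 000, and s_ab the cluster of f_a f_b z: at most
    one of s_12, s_13, s_23 is 0, and in each case the images of z have the
    three other types. *)
Lemma V0_some k : V false (Some k).
Proof.
have [z [oz Nz nN]] := terminal (orb_refl g y0); have Oz := stable_orbit oz.
have [i [j D]] := ix_other k; have [ki kj ij] := D.
have cz l : chi (g l z) = false by rewrite Nz.
have Oi l : O (g l z) by apply: orbit_closed.
suff [l tl] : exists l, has_type (Some k) (g l z).
  by rewrite -(cz l); apply: occurs_here tl; apply: orb_step.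
have ri := terminal_row Oz Nz (nN i) (And3 ij (nesym ki) (nesym kj)).
have rj := terminal_row Oz Nz (nN j) (And3 (nesym ij) (nesym kj) (nesym ki)).
have rk := terminal_row Oz Nz (nN k) D.
rewrite (gC j i) in rj; rewrite (gC k i) (gC k j) in rk.
have [sik|nik] := boolP (chi (g i (g k z))).
  have [sjk|njk] := boolP (chi (g j (g k z))).
    exists k; apply: (@type_two_ones i j) => //; split=> //; exact: nesym.
  have sij : chi (g i (g j z)) by case: rj => // e; rewrite e in njk.
  exists j; apply: (@type_one_zero i k j) => //; first by split=> //; exact: nesym.
  by rewrite gC.
have sij : chi (g i (g j z)) by case: ri => // e; rewrite e in nik.
exists i; apply: (@type_one_zero j k i) => //; rewrite ?(gC k) ?(gC j) //.
by split=> //; exact: nesym.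
Qed.

(** If cluster 1 only has the types 000 and i, a point f_i u of cluster 1 has
    type 000: one of f_j u, f_k u is in cluster 1 and is therefore sent to
    cluster 0 by f_i, so that one of the equal coordinates j and k of f_i u
    is 0. *)
Lemma two_types_in_class1 i j k : distinct3 i j k -> 
  V true (Some j) \/ V true (Some k).
Proof.
move=> D; have [ij ik jk] := D; apply: contrapT => /not_orP[nj nk].
have no a z : a <> i -> Orb y0 z -> chi z -> ~ has_type (Some a) z.
  move=> ai oz cz tz; have : V true (Some a) by rewrite -cz; apply: occurs_here.
  by case: (ix_cases a D) ai => ->.
have c1 z : Orb y0 z -> chi z -> chi (g j z) = chi (g k z).
  move=> oz cz; have Oz := stable_orbit oz; have := class_parity Oz D.
  case: (chi (g i z)) / boolP => ci e.
    case: (boolP (chi (g j z))) => cj.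
      by case: (no k z (nesym ik) oz cz); apply: type_two_ones D ci cj.
    by case: (no j z (nesym ij) oz cz); apply: type_one_zero D ci cj.
  by move: e; case: (chi (g j z)); case: (chi (g k z)).
have c0 z : Orb y0 z -> chi z -> chi (g i z) = false.
  by move=> oz cz; rewrite (class_parity (stable_orbit oz) D) c1 // addbb.
apply: (H2 (y := g i y0)); first exact: orbit_closed.
move=> x /(orb_image sys)[u ou ->] cx; have Ou := stable_orbit ou.
have ox : Orb y0 (g i u) by apply: orb_step.
have c2 : chi (g k (g i u)) = false.
  have [cj|cj] := boolP (chi (g j u)).
    by rewrite -(c1 _ ox cx) gC; apply: c0 => //; apply: orb_step.
  have ck : chi (g k u).
    by have := class_parity Ou D; rewrite cx (negbTE cj) /= => /esym.
  by rewrite gC; apply: c0 => //; apply: orb_step.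
apply: (type_two_zeros (stable_orbit ox) (distinct132 D)); [by rewrite c0|by rewrite c2].
Qed.


(** *** Cluster 1 without type k *)

Section MissingType.
Variables i j k : ix.
Hypothesis D : distinct3 i j k.
Hypothesis nVk : ~ V true (Some k).

Lemma class1_not_k z : Orb y0 z -> chi z -> chi (g i z) -> chi (g j z) -> False.
Proof.
move=> oz cz ci cj; apply: nVk; rewrite -cz; apply: occurs_here => //.
exact: type_two_ones (stable_orbit oz) D ci cj.
Qed.

Lemma class1_coordinates z : Orb y0 z -> chi z -> chi (g j z) -> chi (g k z) /\ ~~ chi (g i z).
Proof.
move=> oz cz cj; have ci : ~~ chi (g i z) by apply/negP => ci; exact: class1_not_k oz cz ci cj.
by rewrite (class_parity (stable_orbit oz) (distinct312 D)) (negbTE ci) cj.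
Qed.

Lemma type_k_line z : Orb y0 z -> ~~ chi z -> (forall n, has_type (Some k) (iter n (g k) z)) -> False.
Proof.
move=> oz cz h; apply: (no_constant_line (stable_orbit oz) D) => n; split=> //.
by case: n => //= n; have := type_self (h n).
Qed.
End MissingType.

(** Were f_i f_j z always in cluster 1, f_k would preserve the points of type k,
    against [no_constant_line]. *)
Lemma type_k_zero_square i j k y : distinct3 i j k -> ~ V true (Some k) -> Orb y0 y ->
  exists z, [/\ Orb y z, has_type (Some k) z & ~~ chi (g i (g j z))].
Proof.
move=> D nV oy; apply: contrapT => no.
have [z [oz cz tz]] := stab oy (V0_some k); rewrite /= in cz tz.
have [ij ik jk] := D.
have step w : Orb y w -> has_type (Some k) w -> has_type (Some k) (g k w).
  move=> ow tw; have s1 : chi (g i (g j w)) by apply: contrapT => /negP h; apply: no; exists w.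
  have o0 := orb_trans oy ow; apply: (type_two_ones (stable_orbit (orb_step k o0)) D).
    rewrite gC; have [] // := class1_coordinates D nV (orb_step i o0) (type_other tw ik).
    by rewrite gC.
  by rewrite gC; have [] // := class1_coordinates (distinct213 D) nV (orb_step j o0) (type_other tw jk).
have line n : Orb y (iter n (g k) z) /\ has_type (Some k) (iter n (g k) z).
  by elim: n => [//|n [a b]]; split; [apply: orb_step|apply: step].
apply: (type_k_line D (orb_trans oy oz)) => [|n]; first by rewrite cz.
by have [] := line n.
Qed.

Lemma type_i_images1 i j k w : distinct3 i j k -> ~ V true (Some k) -> Orb y0 w ->
  has_type (Some i) w -> chi (g i (g j w)) ->
  [/\ has_type (Some k) (g i w), has_type (Some j) (g j w) & has_type (Some i) (g k w)].
Proof.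
move=> D nV ow tw s1; have [ij ik jk] := D.
have cj := type_other tw (nesym ij); have ck := type_other tw (nesym ik).
have [a1 a2] := class1_coordinates (distinct213 D) nV (orb_step j ow) cj s1.
have b : chi (g j (g k w)) by rewrite gC.
have [b1 b2] := class1_coordinates D nV (orb_step k ow) ck b.
split.
- by refine (type_one_zero (stable_orbit (orb_step i ow)) (distinct231 D) _ _); rewrite gC.
- exact: type_one_zero (stable_orbit (orb_step j ow)) D s1 a2.
- exact: type_two_ones (stable_orbit (orb_step k ow)) (distinct231 D) b b1.
Qed.

(** The points f_i z_n have type k and form a line in cluster 0. *)
Lemma type_i_line i j k z : distinct3 i j k -> ~ V true (Some k) -> Orb y0 z ->
  (forall n, has_type (Some i) (iter n (g k) z) /\ chi (g i (g j (iter n (g k) z)))) -> False.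
Proof.
move=> D nV oz h; have [t0 _] := h 0%N.
apply: (type_k_line D (orb_step i oz) (type_self t0)) => n.
have [tn sn] := h n; rewrite (iterC sys).
by have [] := type_i_images1 D nV (orb_iter n k oz) tn sn.
Qed.

Lemma type_i_zero_square i j k y : distinct3 i j k -> ~ V true (Some k) -> V true (Some i) ->
  Orb y0 y -> exists z, [/\ Orb y z, has_type (Some i) z & ~~ chi (g i (g j z))].
Proof.
move=> D nV Vi oy; apply: contrapT => no.
have [z [oz _ tz]] := stab oy Vi; rewrite /= in tz.
have s1 w : Orb y w -> has_type (Some i) w -> chi (g i (g j w)).
  by move=> ow tw; apply: contrapT => /negP h; apply: no; exists w.
have line n : Orb y (iter n (g k) z) /\ has_type (Some i) (iter n (g k) z).
  elim: n => [//|n [a b]]; split; first exact: orb_step.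
  by have [] := type_i_images1 D nV (orb_trans oy a) b (s1 _ a b).
by apply: (type_i_line D nV (orb_trans oy oz)) => n; have [a b] := line n; split=> //; apply: s1.
Qed.

Lemma type_i_images0 i j k w : distinct3 i j k -> ~ V true (Some k) -> ~ V false None -> Orb y0 w ->
  has_type (Some i) w -> ~~ chi (g i (g j w)) ->
  [/\ has_type (Some j) (g i w), has_type None (g j w) & has_type (Some j) (g k w)].
Proof.
move=> D nV nN ow tw s0; have [ij ik jk] := D.
have cj := type_other tw (nesym ij); have ck := type_other tw (nesym ik).
have s0' : ~~ chi (g j (g i w)) by rewrite gC.
have sik : chi (g i (g k w)).
  apply: contrapT => /negP h; apply: nN; rewrite -(negbTE (type_self tw)).
  apply: occurs_here (orb_step i ow) _.
  by refine (type_two_zeros (stable_orbit (orb_step i ow)) (distinct231 D) _ _) => //; rewrite gC.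
have sik' : chi (g k (g i w)) by rewrite gC.
have [a1 a2] := class1_coordinates (distinct213 D) nV (orb_step k ow) ck sik.
split.
- exact: (type_one_zero (stable_orbit (orb_step i ow)) (distinct321 D) sik' s0').
- by refine (type_two_zeros (stable_orbit (orb_step j ow)) (distinct132 D) _ _) => //; rewrite gC.
- exact: type_one_zero (stable_orbit (orb_step k ow)) D sik a2.
Qed.

Lemma type_unique t t' z : has_type t z -> has_type t' z -> t = t'.
Proof.
move=> h h'; have e l : even_word t l = even_word t' l by rewrite -h -h'.
by move: t t' e {h h'} => [[]|] [[]|] // e; have := e I1; have := e I2; have := e I3.
Qed.

(** If some point x of type i has f_i f_j x in cluster 1, the same holds for f_k
    x, hence along an f_k-line, against [type_i_line]. Otherwise f_i x and
    f_k x have type j by [type_i_images0], and f_i f_k x has type i as an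
    image of one and type 000 as an image of the other. *)
Lemma both_missing_absurd i j k : distinct3 i j k -> ~ V true (Some k) -> ~ V false None ->
  ~ V true (Some i).
Proof.
move=> D nV nN [x [ox _ tx]]; rewrite /= in tx.
have noA i' j' w : distinct3 i' j' k -> Orb y0 w -> has_type (Some i') w -> ~~ chi (g i' (g j' w)).
  move=> D' ow tw; apply/negP => sw.
  suff line n : Orb y0 (iter n (g k) w) /\ 
      (has_type (Some i') (iter n (g k) w) /\ chi (g i' (g j' (iter n (g k) w)))).
    by apply: (type_i_line D' nV ow) => n; have [] := line n.
  elim: n => [//|n [on_centre [t s1]]]; split; first exact: orb_step.
  have [_ t2 t3] := type_i_images1 D' nV on_centre t s1; split=> //=.
  apply: contrapT => /negP s0.
  have [_ t4 _] := type_i_images0 D' nV nN (orb_step k on_centre) t3 s0; rewrite gC in t4.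
  have oj := orb_step j' on_centre.
  have [s2|s2] := boolP (chi (g j' (g i' (g j' (iter n (g k) w))))).
    by have [_ _ /(type_unique t4)] := type_i_images1 (distinct213 D') nV oj t2 s2.
  by have [_ _ /(type_unique t4)] := type_i_images0 (distinct213 D') nV nN oj t2 s2.
have [t1 _ t3] := type_i_images0 D nV nN ox tx (noA _ _ _ D ox tx).
have o1 := orb_step i ox; have o3 := orb_step k ox.
have [_ _ t4] := type_i_images0 (distinct213 D) nV nN o1 t1 (noA _ _ _ (distinct213 D) o1 t1).
have [_ t5 _] := type_i_images0 (distinct213 D) nV nN o3 t3 (noA _ _ _ (distinct213 D) o3 t3).
by rewrite gC in t4; have := type_unique t4 t5.
Qed.

(** *** Shrinking the clusters *)

Section Shrink.
Variables (y : X) (delta : R).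
Hypothesis oy : Orb y0 y.
Hypothesis hd : forall x u, Orb y x -> Orb y u -> chi x = chi u -> d x u <= delta.
Let eta := 2 * lam * delta.

Definition piece i s v w := exists u, [/\ Orb y u, chi u = s, w = g i u & chi w = v].

Lemma delta_ge0 : 0 <= delta.
Proof. by apply: le_trans (hd (orb_refl g y) (orb_refl g y) erefl). Qed.

Lemma lam_delta_ge0 : 0 <= lam * delta.
Proof. by apply: mulr_ge0; [apply/ltW/(lam_gt0 sys)|exact: delta_ge0]. Qed.

(** Points of different types which agree at i are contracted by i; when u and
    u' have the same type, a point of the other available type serves as an
    intermediate. *)
Lemma good_piece t t' i s v : V s t -> V s t' -> t <> t' -> even_word t i = v -> even_word t' i = v ->
  forall w w', piece i s v w -> piece i s v w' -> d w w' <= eta.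
Proof.
move=> Vt Vt' ne ti t'i w w' [u [ou cu -> iu]] [u' [ou' cu' -> iu']].
have e0 := lam_delta_ge0.
have key a b : Orb y a -> Orb y b -> chi a = s -> chi b = s -> chi (g i a) = v -> chi (g i b) = v ->
    (exists l, chi (g l a) <> chi (g l b)) -> d (g i a) (g i b) <= lam * delta.
  move=> oa ob ca cb ia ib nab.
  have : contr i a b.
    by apply: contr_agree nab; rewrite ?ca ?cb ?ia ?ib //; apply: stable_orbit; apply: orb_trans oy _.
  by move/le_trans; apply; apply: (lam_monotone sys); apply: hd; rewrite ?ca ?cb.
have [n|n] := pselect (exists l, chi (g l u) <> chi (g l u')).
  by have := key _ _ ou ou' cu cu' iu iu' n; rewrite /eta; lra.
have [t0 tu] := type_exists (stable_orbit (orb_trans oy ou)).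
have [t1 [V1 t10 t1i]] : exists t1, [/\ V s t1, t1 <> t0 & even_word t1 i = v].
  have [e|] := pselect (t = t0); last by exists t.
  by exists t'; split=> //; rewrite -e; exact: nesym.
have [z [oz cz tz]] := stab oy V1; rewrite /= in cz tz.
have zi : chi (g i z) = v by rewrite tz.
have nz : exists l, chi (g l u) <> chi (g l z).
  apply: contrapT => h; apply: t10.
  by apply: (type_unique tz) => l; rewrite -tu; apply: contrapT => n'; apply: h; exists l => /esym.
have nz' : exists l, chi (g l z) <> chi (g l u').
  have [l hl] := nz; exists l => e; apply: hl; rewrite e; apply: contrapT => n'.
  by apply: n; exists l.
have h1 := key _ _ ou oz cu cz iu zi nz; have h2 := key _ _ oz ou' cz cu' zi iu' nz'.
by have := dtri (g i z) (g i u) (g i u'); rewrite /eta; lra.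
Qed.

(** The link between pieces. *)
Lemma corner i j z : Orb y z ->
  piece i (chi (g j z)) (chi (g i (g j z))) (g i (g j z)) /\
  piece j (chi (g i z)) (chi (g i (g j z))) (g i (g j z)).
Proof.
move=> oz; split; first by exists (g j z); split=> //; apply: orb_step.
by exists (g i z); split=> //; apply: orb_step.
Qed.

(** A graph on three vertices without isolated vertex is connected. *)
Lemma three_pieces (Q : ix -> X -> Prop) : 
  (forall i w w', Q i w -> Q i w' -> d w w' <= eta) ->
  (forall i, exists a h, [/\ a <> i, Q i h & Q a h]) ->
  forall i j w w', Q i w -> Q j w' -> d w w' <= 3 * eta.
Proof.
move=> good link i j w w' iw jw'.
have e0 : 0 <= eta by rewrite /eta; have := lam_delta_ge0; lra.
have [e|ij] := pselect (i = j); first by subst j; have := good _ _ _ iw jw'; lra.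
have [k D] := ix_third ij; have [_ ik jk] := D.
have two h : Q i h -> Q j h -> d w w' <= 3 * eta.
  move=> ih jh; have := good _ _ _ iw ih; have := good _ _ _ jh jw'.
  by have := dtri h w w'; lra.
have [a [h [ai ih ah]]] := link i; have [b [h' [bj jh' bh']]] := link j.
case: (ix_cases a D) ai ah => -> // _; first exact: two.
case: (ix_cases b D) bj bh' => -> // _ bh' ah; first exact: two bh' jh'.
have := good _ _ _ iw ih; have := good _ _ _ ah bh'; have := good _ _ _ jh' jw'.
by have := dtri h w w'; have := dtri h' h w'; lra.
Qed.

Lemma deep_perm i j k x : distinct3 i j k -> g I1 (g I2 (g I3 x)) = g i (g j (g k x)).
Proof.
have c i' j' z : g i' (g j' z) = g j' (g i' z) by rewrite gC.
case=> ij ik jk; move: i j k ij ik jk => [] [] [] ij ik jk; try by [case: ij|case: ik|case: jk].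
- by [].
- by rewrite (c I2 I3).
- by rewrite (c I1 I2).
- by rewrite (c I1 I2) (c I1 I3).
- by rewrite (c I2 I3) (c I1 I3).
- by rewrite (c I2 I3) (c I1 I3) (c I1 I2).
Qed.

Notation y' := (g I1 (g I2 (g I3 y))).

Lemma deep_piece w l : Orb y' w -> exists s, piece l s (chi w) w.
Proof.
move=> /(orb_image sys)[w1 /(orb_image sys)[w2 /(orb_image sys)[x ox ->] ->] ->].
have [i [j D]] := ix_other l; rewrite (deep_perm x D).
by eexists; exists (g i (g j x)); split=> //; do 2! apply: orb_step.
Qed.

Lemma deep_split w : Orb y' w -> exists2 x, Orb y x & w = g I1 (g I2 (g I3 x)).
Proof.
by move=> /(orb_image sys)[w1 /(orb_image sys)[w2 /(orb_image sys)[x ox ->] ->] ->]; exists x.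
Qed.

(** The six pieces coming from cluster 1 are small. A point x = f_i u of cluster
    1 whose type has equal coordinates v in the two places other than i
    links the i-th piece landing in cluster v to a second one ([src],
    [pick]). A point all of whose predecessors are in cluster 0 belongs to a
    small piece linked to the former ones; it cannot be in cluster 0 if type
    000 does not occur there. *)
Lemma shrink_full : (forall t, V true t) -> forall w w', Orb y' w -> Orb y' w' -> chi w = chi w' ->
  d w w' <= 5 * eta.
Proof.
move=> V1 w w' ow ow' ev.
have e0 : 0 <= eta by rewrite /eta; have := lam_delta_ge0; lra.
have good1 i v u u' : piece i true v u -> piece i true v u' -> d u u' <= eta.
  case: v; last by apply: (@good_piece None (Some i)); rewrite ?even_word_self.
  have [j [k [ij ik jk]]] := ix_other i.
  apply: (@good_piece (Some j) (Some k)) => //; rewrite ?even_word_other //.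
  by case=> /jk.
have src i v : exists u, [/\ Orb y u, chi (g i u) & forall l, l <> i -> chi (g l (g i u)) = v].
  have [x [ox cx tx]] := stab (orb_step i oy) (V1 (if v then Some i else None)).
  have [u ou eu] := orb_image sys ox; rewrite /= eu in cx tx.
  by exists u; split=> // l li; rewrite tx; case: (v) => //; rewrite even_word_other.
have pick i v b : exists a h, [/\ a <> i, piece i b v h & piece a true v h].
  have [u [ou ci cl]] := src i v; have [j [k D]] := ix_other i; have [ij ik jk] := D.
  suff [a [ai ca]] : exists a, a <> i /\ chi (g a u) = b.
    have [h1 h2] := corner i a ou; exists a, (g i (g a u)).
    by rewrite ca ci in h1 h2; rewrite gC (cl a ai) -gC in h1 h2.
  have := class_parity (stable_orbit (orb_trans oy ou)) D; rewrite ci.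
  have [cj|cj] := eqVneq (chi (g j u)) b; first by exists j; split=> //; exact: nesym.
  move=> e; exists k; split; first exact: nesym.
  by move: e cj; case: (chi (g j u)) (chi (g k u)) (b) => [] [] [].
have near u : Orb y' u -> exists a h, piece a true (chi u) h /\ d u h <= eta.
  move=> ou; have [[l pl]|no] := pselect (exists l, piece l true (chi u) u).
    by exists l, u; rewrite (dxx sys).
  have q0 l : piece l false (chi u) u.
    by have [[] pl] := deep_piece l ou => //; case: no; exists l.
  have [a [h [_ ph pa]]] := pick I1 (chi u) false; exists a, h; split=> //.
  move: (q0 I1) ph => pu ph; case: (boolP (chi u)) pu ph => cu pu ph.
    by apply: (@good_piece (Some I2) (Some I3) I1 false true) => //; apply: V0_some.
  have [VN|nVN] := pselect (V false None).
    by apply: (@good_piece None (Some I1) I1 false false) => //; apply: V0_some.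
  exfalso; have [x ox ex] := deep_split ou; have o0 := orb_trans oy ox.
  have c2 a1 b1 c1 : distinct3 a1 b1 c1 -> ~~ chi (g a1 (g b1 x)).
    move=> Da; apply/negP => hab; apply: no; exists c1, (g a1 (g b1 x)); split=> //.
      by do 2! apply: orb_step.
    by rewrite ex (deep_perm x (distinct312 Da)).
  have [l cl] : exists l, chi (g l x) = false.
    by have [[l|] tx] := type_exists (stable_orbit o0); [exists l|exists I1]; rewrite tx ?even_word_self.
  have [a1 [b1 D]] := ix_other l; apply: nVN; rewrite -cl; apply: occurs_here (orb_step l o0) _.
  exact: type_two_zeros (stable_orbit (orb_step l o0)) (distinct231 D) (c2 _ _ _ (distinct213 D)) (c2 _ _ _ (distinct312 D)).
move: (near w ow) (near w' ow'); rewrite -ev.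
move: (chi w) => v [a [h [pa dh]]] [a' [h' [pa' dh']]].
have link i : exists a h, [/\ a <> i, piece i true v h & piece a true v h] by exact: pick.
have := @three_pieces (fun a => piece a true v) (fun i => @good1 i v) link _ _ _ _ pa pa'.
rewrite (dsym w') in dh'; have := dtri h w w'; have := dtri h' h w'; lra.
Qed.

(** All the pieces coming from cluster 0 are small, and they are linked through
    a terminal point when they land in cluster 1. The remaining small pieces
    are (i, 1, 0), (j, 1, 0) and (k, 1, 1). In cluster 0, the link is given
    by [type_i_zero_square] and [type_k_zero_square]. In cluster 1, either a
    point of type k links (k, 1, 1) to the others, or every deep point has a
    predecessor in cluster 0. *)
Lemma shrink_missing i j k : distinct3 i j k -> ~ V true (Some k) ->
  V true (Some i) -> V true (Some j) -> V false None ->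
  forall w w', Orb y' w -> Orb y' w' -> chi w = chi w' -> d w w' <= 5 * eta.
Proof.
move=> D nV Vi Vj VN w w' ow ow' ev; have [ij ik jk] := D.
have e0 : 0 <= eta by rewrite /eta; have := lam_delta_ge0; lra.
have V0 t : V false t by case: t => [l|//]; exact: V0_some.
have good0 l v u u' : piece l false v u -> piece l false v u' -> d u u' <= eta.
  case: v; last by apply: (@good_piece None (Some l)); rewrite ?even_word_self.
  have [a [b [la lb ab]]] := ix_other l.
  by apply: (@good_piece (Some a) (Some b)) => //; rewrite ?even_word_other // => -[] /ab.
have good10 l u u' : l <> k -> piece l true false u -> piece l true false u' -> d u u' <= eta.
  move=> lk; apply: (@good_piece None (Some l)); rewrite ?even_word_self //; first exact: no_missing_none.
  by case: (ix_cases l D) lk => ->.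
have good11 u u' : piece k true true u -> piece k true true u' -> d u u' <= eta.
  apply: (@good_piece (Some i) (Some j) k) => //; first by case=> /ij.
    exact: even_word_other (nesym ik).
  exact: even_word_other (nesym jk).
have [cw|cw] := boolP (chi w); last first.
  (* Both points lie in the pieces of index j, one for each class of the j-th
     predecessor; a point of type i and a point of type k link these two pieces
     through the piece of index i and class 1. *)
  have cw' : chi w' = false by rewrite -ev; exact: negbTE.
  have [s pw] := deep_piece j ow; have [s' pw'] := deep_piece j ow'.
  rewrite (negbTE cw) in pw; rewrite cw' in pw'.
  have [z [oz tz sz]] := type_i_zero_square D nV Vi oy.
  have [q [oq tq sq]] := type_k_zero_square D nV oy.
  have [hi hj] := corner i j oz; have [ki kj] := corner i j oq.
  rewrite (negbTE (type_self tz)) (type_other tz (nesym ij)) (negbTE sz) in hi hj.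
  rewrite (type_other tq ik) (type_other tq jk) (negbTE sq) in ki kj.
  have h1 := good10 _ _ _ ik hi ki; set h := g i (g j z) in hi hj h1; set h' := g i (g j q) in ki kj h1.
  have cross u u' : piece j true false u -> piece j false false u' -> d u u' <= 3 * eta.
    move=> pu pu'; have := good10 _ _ _ jk pu kj; have := good0 _ _ _ _ hj pu'.
    by have := dtri h' u u'; have := dtri h h' u'; rewrite (dsym h' h); lra.
  case: s s' pw pw' => -[] pw pw'.
  - by have := good10 _ _ _ jk pw pw'; lra.
  - by have := cross _ _ pw pw'; lra.
  - by have := cross _ _ pw' pw; rewrite dsym; lra.
  - by have := good0 _ _ _ _ pw pw'; lra.
have cw' : chi w' = true by rewrite -ev.
have [z [oz Nz nN]] := terminal oy; have oy0z := orb_trans oy oz.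
have link l : exists a h, [/\ a <> l, piece l false true h & piece a false true h].
  have [a [b [la lb ab]]] := ix_other l.
  have [|] := terminal_row (stable_orbit oy0z) Nz (nN l) (And3 la lb ab).
    by move=> e; have [h1 h2] := corner l a oz; exists a, (g l (g a z));
      rewrite !Nz e in h1 h2; split=> //; exact: nesym.
  by move=> e; have [h1 h2] := corner l b oz; exists b, (g l (g b z));
      rewrite !Nz e in h1 h2; split=> //; exact: nesym.
have d0 := @three_pieces (fun a => piece a false true) (fun i => @good0 i true) link.
have [[q [oq tq sq]]|no] := pselect (exists q, [/\ Orb y q, has_type (Some k) q &
    exists2 a, a <> k & chi (g a (g k q))]).
  have [a ak sa] := sq; have [ha hk] := corner a k oq.
  rewrite (negbTE (type_self tq)) (type_other tq ak) sa in ha hk.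
  set h := g a (g k q) in ha hk.
  have cross u u' : piece k true true u -> piece k false true u' -> d u u' <= 4 * eta.
    by move=> pu pu'; have := good11 _ _ pu hk; have := d0 _ _ _ _ ha pu'; have := dtri h u u'; lra.
  have [s pw] := deep_piece k ow; have [s' pw'] := deep_piece k ow'.
  rewrite cw in pw; rewrite cw' in pw'.
  case: s s' pw pw' => -[] pw pw'.
  - by have := good11 _ _ pw pw'; lra.
  - by have := cross _ _ pw pw'; lra.
  - by have := cross _ _ pw' pw; rewrite dsym; lra.
  - by have := good0 _ _ _ _ pw pw'; lra.
have some u : Orb y' u -> chi u = true -> exists l, piece l false true u.
  move=> ou cu; apply: contrapT => none; have [x ox ex] := deep_split ou.
  have cl a b c : distinct3 a b c -> chi (g a (g b x)).
    move=> Da; apply: contrapT => /negP h; apply: none; exists c.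
    exists (g a (g b x)); split; first by do 2! apply: orb_step.
    - exact: negbTE.
    - by rewrite ex (deep_perm x (distinct312 Da)).
    - exact: cu.
  have oxk : Orb y (g k x) by apply: orb_step.
  have o0 := orb_trans oy oxk.
  have tk : has_type (Some k) (g k x) by apply: (type_two_ones (stable_orbit o0) D (cl _ _ _ (distinct132 D)) (cl _ _ _ (distinct231 D))).
  have sij : chi (g i (g j (g k x))) by rewrite -(deep_perm x D) -ex.
  have si : chi (g k (g i (g k x))).
    have [] // := class1_coordinates D nV (orb_step i o0) (type_other tk ik).
    by rewrite gC.
  by apply: no; exists (g k x); split=> //; exists i; rewrite // gC.
have [l pl] := some w ow cw; have [l' pl'] := some w' ow' cw'.
by have := d0 _ _ _ _ pl pl'; lra.
Qed.
End Shrink.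

End Stable.

(** The diameters of the clusters tend to 0 along the orbits of (f_1 f_2 f_3)^n
    y0, each of which has a point of type 1 in cluster 0; such a point and
    its image by f_1 are in the same cluster. *)
Theorem two_clusters_absurd : False.
Proof.
have [y0 Oy0 st] := @stabilize X (bool * option ix) Orb occurs
  [:: (true, None); (true, Some I1); (true, Some I2); (true, Some I3);
      (false, None); (false, Some I1); (false, Some I2); (false, Some I3)]
  (orb_refl g) (@orb_trans _ g)
  (fun x y t xy oy => let: ex_intro z (And3 a b c) := oy in ex_intro _ z (And3 (orb_trans xy a) b c)) p0.
have stab t z : Orb y0 z -> occurs y0 t -> occurs z t.
  by apply: st; case: t => -[] [[]|] /=; tauto.
have step y delta : Orb y0 y -> (forall x u, Orb y x -> Orb y u -> chi x = chi u -> d x u <= delta) ->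
    forall x u, Orb (g I1 (g I2 (g I3 y))) x -> Orb (g I1 (g I2 (g I3 y))) u -> chi x = chi u ->
    d x u <= 5 * (2 * lam * delta).
  move=> oy hd; have [[k nV]|all] := pselect (exists k, ~ occurs y0 (true, Some k)); last first.
    apply: (shrink_full Oy0 stab oy hd) => -[k|]; last exact: no_missing_none Oy0.
    by apply: contrapT => n; apply: all; exists k.
  have [a [b D']] := ix_other k; have D := distinct231 D'.
  have Va : occurs y0 (true, Some a).
    by case: (two_types_in_class1 Oy0 (distinct213 D)) => //.
  have Vb : occurs y0 (true, Some b).
    by case: (two_types_in_class1 Oy0 D) => //.
  have [VN|nN] := pselect (occurs y0 (false, None)); last by case: (both_missing_absurd Oy0 D nV nN Va).
  exact: (shrink_missing Oy0 stab oy hd D nV Va Vb VN).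
pose Y n := iter n (fun y => g I1 (g I2 (g I3 y))) y0.
have YS n : Orb (Y n) (Y n.+1) by do 3! apply: orb_step; apply: orb_refl.
have oY n : Orb y0 (Y n) by elim: n => [|n IH]; [apply: orb_refl|apply: orb_trans IH (YS n)].
have bd n : forall x u, Orb (Y n) x -> Orb (Y n) u -> chi x = chi u -> d x u <= M * 2^-1 ^+ n.
  elim: n => [x u ox ou e|n IH x u ox ou e].
    by rewrite expr0 mulr1; apply: (class_bounded TC) => //; apply: orb_trans Oy0 _.
  have := step _ _ (oY n) IH x u ox ou e.
  have h0 : 0 <= M * 2^-1 ^+ n by apply: le_trans (IH _ _ (orb_refl g _) (orb_refl g _) erefl).
  by have := lam_negligible sys h0 (c := 1 / 20); rewrite exprSr mulrA; lra.
have ex n : exists x, [/\ Orb (Y n) x, ~~ chi x & ~~ chi (g I1 x)].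
  have [x [ox cx tx]] := stab _ _ (oY n) (V0_some Oy0 stab I1).
  by exists x; split=> //; [rewrite cx|exact: type_self tx].
have [u hu] := choice ex.
apply: (no_convergence sys (u := u) (C := M)) => n; have [ox cx cgx] := hu n.
  have [ox' cx' _] := hu n.+1; apply: bd => //; first exact: orb_trans (YS n) ox'.
  by rewrite (negbTE cx) (negbTE cx').
exists I1; apply: bd => //; first exact: orb_step.
by rewrite (negbTE cx) (negbTE cgx).
Qed.
End Clusters.

(** * The majority case is impossible *)

Section CommonCentre.
Variables (R : realType) (X : Type) (d : X -> X -> R) (g : ix -> X -> X) (lam : R).
Hypothesis sys : system d g lam.
Let dge0 := dge0 sys.
Let dsym := dsym sys.
Let dtri := dtri sys.
Let gC := gC sys.
Notation Orb := (in_orbit g).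
Notation contr := (contracts d g lam).
Notation rho := (displacement d g).

Variables (p c : X) (nu th r : R).
Hypothesis nu0 : 0 < nu.
Hypothesis low : forall u, Orb p u -> nu <= rho u.
Hypothesis high : rho p <= 2 * nu.
Hypothesis pc : d p c <= r.
Hypothesis lamr : lam * r <= nu / 100.
Hypothesis th0 : 0 <= th.
Hypothesis thnu : th <= nu / 100.
Hypothesis start : exists2 x, Orb p x & d x c <= th.
Hypothesis maj : forall w i j, Orb p w -> d w c <= th -> i <> j ->
  d (g i w) c <= th \/ d (g j w) c <= th.

(** Let Q be the set of points reached by walks from a point given by
    [constant_exit]: they are close to c and all leave by k. Let y in Q have
    an almost minimal jump d(y, f_k y), and z = f_k y. A pair (u, z) with u
    in Q is not contracted by l <> k, which would give f_l y a shorter jump;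
    so it is contracted by k, the displacement of z is negligible with
    respect to the jump, and [distance_le_displacements] bounds the jump. *)
Theorem common_centre_absurd : False.
Proof.
pose P w := Orb p w /\ d w c <= th.
move: nu0 high pc lamr th0 thnu => nu0' high' pc' lamr' th0' thnu'.
have close x y : d x c <= th -> d y c <= th -> d x y <= 2 * th.
  by move=> hx hy; have := dtri c x y; rewrite (dsym c y); lra.
have hm w : exists i, P w -> nu <= d w (g i w).
  have [Pw|] := pselect (P w); last by exists I1.
  by have [i hi] := displacement_witness (low Pw.1); exists i.
have [m Hm] := choice hm.
have far w : P w -> ~ (d (g (m w) w) c <= th).
  by move=> Pw h; have := Hm w Pw; have := close _ _ Pw.2 h; lra.
have hP x : P x -> forall i, P (g i x) <-> i <> m x.
  move=> Px i; split=> [[_ h] e|im]; first by rewrite e in h; case: (far x Px).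
  split; first by apply: orb_step; case: Px.
  by have [//|/(far x Px)] := maj Px.1 Px.2 im.
have hc x u : P x -> P u -> m x <> m u -> ~ contr (m x) x u.
  move=> Px Pu ne h; have [_ hu] : P (g (m x) u) by apply/hP.
  have h1 := Hm x Px; have h2 := dtri c x (g (m x) x).
  have h3 := dtri (g (m x) u) c (g (m x) x); have h4 := Px.2.
  rewrite (dsym c (g (m x) u)) (dsym (g (m x) u) (g (m x) x)) in h3.
  have xu := close _ _ Px.2 Pu.2; move: h; rewrite /contracts.
  by have := lam_negligible sys (dge0 x u) (c := 1); lra.
have hM x u : P x -> P u -> d x u <= 2 * th by move=> Px Pu; exact: close Px.2 Pu.2.
have [x0 ox0 cx0] := start.
have [x [k [_ Px hw]]] := constant_exit sys hP hc hM (conj ox0 cx0).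
have PQ y : walk g m x y -> P y by apply: walkP hP _ _ Px.
pose N y := d y (g k y).
move: nu0' high' pc' lamr' th0' thnu' => nu0' high' pc' lamr' th0' thnu'.
have Nlow y : walk g m x y -> nu <= N y.
  by move=> wy; have := Hm y (PQ y wy); rewrite hw.
have [y wy ymin] := almost_min (ex_intro _ x (walk0 g m x)) nu0 Nlow.
have Ny := Nlow y wy; set z := g k y.
have step l u : walk g m x u -> l <> k -> walk g m x (g l u).
  by move=> wu lk; apply: walkS; rewrite ?hw.
have key u : walk g m x u -> d (g k u) (g k z) <= 2 * (lam * N y).
  move=> wu; have uy := close _ _ (PQ u wu).2 (PQ y wy).2.
  have uz : d u z <= 2 * N y by have := dtri y u z; rewrite -/(N y); lra.
  have luz := lam_monotone sys uz.
  have [l hl] := contractive sys u z; have [e|lk] := pselect (l = k).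
    by move: hl; rewrite e /contracts; lra.
  have wl := step l y wy lk; have wlu := step l u wu lk.
  have h1 := ymin _ wl; have h2 := close _ _ (PQ _ wl).2 (PQ _ wlu).2.
  have : N (g l y) <= 2 * th + lam * d u z.
    rewrite /N (gC k l); have := dtri (g l u) (g l y) (g l (g k y)).
    by move: hl; rewrite /contracts -/z; lra.
  by have := lam_negligible sys (dge0 u z) (c := 1 / 100); lra.
have rz : rho z <= 4 * (lam * N y).
  apply: displacement_le => l; have l0 : 0 <= lam * N y.
    by apply: mulr_ge0; [apply/ltW/(lam_gt0 sys)|apply: dge0].
  have [->|lk] := pselect (l = k); first by have := key y wy; rewrite -/z; lra.
  have := key y wy; have := key _ (step l y wy lk); rewrite (gC k l) -/z.
  by have := dtri (g k z) z (g l z); rewrite (dsym (g k z) (g l z)); lra.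
have oz : Orb p z by apply: orb_step; case: (PQ y wy).
have zlow := low oz.
have pz := distance_le_displacements sys p z.
have r0 : 0 <= r by apply: le_trans pc.
have Nn : N y <= th + r + d p z.
  have := dtri c y z; have := dtri p c z; have := (PQ y wy).2.
  by rewrite (dsym c p) -/(N y); lra.
have h1 := lam_negligible sys (dge0 p z) (c := 1 / 100).
have h2 := lam_negligible sys (dge0 y z) (c := 1 / 100).
have Nb : N y <= 2 * r + 5 * nu by move: h2; rewrite -/(N y); lra.
have := lam_monotone sys Nb; have := lam_negligible sys (ltW nu0) (c := 1 / 100); lra.
Qed.
End CommonCentre.

(** * The picture at an almost minimal point *)

Definition ix_ord (i : ix) : 'I_3 :=
  match i with I1 => @Ordinal 3 0 isT | I2 => @Ordinal 3 1 isT | I3 => @Ordinal 3 2 isT end.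
Definition ord_ix (k : 'I_3) : ix := match val k with 0%N => I1 | 1%N => I2 | _ => I3 end.
Lemma ix_ordK : cancel ix_ord ord_ix. Proof. by case. Qed.
HB.instance Definition _ := Finite.copy ix (can_type ix_ordK).

Lemma card_ix : #|{: ix}| = 3%N.
Proof.
rewrite -[RHS]card_ord; apply: bij_eq_card (ix_ord) _; exists ord_ix; first exact: ix_ordK.
by case=> -[|[|[|//]]] i; apply: val_inj.
Qed.


(** Chains in a finite family of points turn closeness into an equivalence
    relation, at the cost of a factor equal to the size of the family. *)
Section Chains.
Variables (R : realType) (X : Type) (d : X -> X -> R).
Hypothesis dxx : forall x, d x x = 0.
Hypothesis dsym : forall x y, d x y = d y x.
Hypothesis dtri : forall y x z, d x z <= d x y + d y z.
Variables (I : finType) (pt : I -> X).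

Definition hop e : rel I := [rel a b | d (pt a) (pt b) <= e].
Definition chain e x y := x = y \/ exists a b, [/\ pt a = x, pt b = y & connect (hop e) a b].

Lemma chain_refl e x : chain e x x. Proof. by left. Qed.

Lemma chain_sym e x y : chain e x y -> chain e y x.
Proof.
case=> [->|[a [b [ax bx c]]]]; first exact: chain_refl.
right; exists b, a; split=> //; rewrite sym_connect_sym // => a' b'.
by rewrite /hop /= dsym.
Qed.

Lemma chain_trans e y x z : 0 <= e -> chain e x y -> chain e y z -> chain e x z.
Proof.
move=> e0 [->//|[a [b [ax bx c]]]] [<-|[a' [b' [ax' bx' c']]]].
  by right; exists a, b.
right; exists a, b'; split=> //; apply: connect_trans c _.
by apply: connect_trans c'; apply: connect1; rewrite /hop /= bx ax' dxx.
Qed.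

Lemma chain_hop e a b : d (pt a) (pt b) <= e -> chain e (pt a) (pt b).
Proof. by move=> h; right; exists a, b; split=> //; apply: connect1. Qed.

Lemma chain_mono e e' x y : e <= e' -> chain e x y -> chain e' x y.
Proof.
move=> ee' [->|[a [b [ax bx c]]]]; first exact: chain_refl.
right; exists a, b; split=> //; apply: connect_sub c => a' b' /= h.
by apply: connect1; apply: le_trans h ee'.
Qed.

Lemma chain_dist e x y : 0 <= e -> chain e x y -> d x y <= #|I|%:R * e.
Proof.
move=> e0 [->|[a [b [<- <- /connectP[s ps ->]]]]].
  by rewrite dxx mulr_ge0.
have [s' ps' us' _] := shortenP ps.
have : d (pt a) (pt (last a s')) <= (size s')%:R * e.
  elim: s' a {ps us'} ps' => [|c s' IH] a /=; first by rewrite dxx mul0r.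
  move=> /andP[+ /IH h]; rewrite /hop /= => ac; have := dtri (pt c) (pt a) (pt (last c s')).
  by rewrite -natr1 mulrDl mul1r; lra.
move/le_trans; apply; apply: ler_wpM2r => //; rewrite ler_nat.
by have := max_card (mem (a :: s')); rewrite (card_uniqP us') /=; apply: leq_trans.
Qed.
End Chains.

(** Pairwise intersecting triples without a common value have a centre. *)
Section Triad.
Variables (U Y : Type) (f : ix -> U -> Y) (T : Y -> Y -> Prop).
Hypothesis sameR : forall x, T x x.
Hypothesis sameS : forall x y, T x y -> T y x.
Hypothesis sameT : forall y x z, T x y -> T y z -> T x z.
Variable F : U -> Prop.
Hypothesis meet : forall u v, F u -> F v -> exists i, T (f i u) (f i v).
Hypothesis nostar : forall i, exists u v, [/\ F u, F v & ~ T (f i u) (f i v)].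

(** Take u, v agreeing in exactly one coordinate i, and w which differs from
    them at i: w agrees with u in one of the other coordinates and with v in
    the last one. If all pairs agreed in two coordinates, all would agree in
    one of the coordinates. *)
Lemma triad : exists x : ix -> U, exists P : ix -> U, forall i,
  [/\ F (x i), F (P i), ~ T (f i (x i)) (f i (P i)) & 
      forall j, i <> j -> T (f i (x j)) (f i (P i))].
Proof.
have [[i [j [k [u [v [D Fu Fv [ti nj nk]]]]]]]|no] := pselect (exists i j k u v,
  [/\ distinct3 i j k, F u, F v & [/\ T (f i u) (f i v), ~ T (f j u) (f j v) & ~ T (f k u) (f k v)]]).
- have [ij ik jk] := D.
  have [w Fw nw] : exists2 w, F w & ~ T (f i w) (f i u).
    have [a [b [Fa Fb nab]]] := nostar i.
    have [ta|na] := pselect (T (f i a) (f i u)); last by exists a.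
    by exists b => // tb; apply: nab; apply: sameT ta (sameS tb).
  wlog [uj vk] : j k D nj nk ij ik jk / T (f j u) (f j w) /\ T (f k v) (f k w).
    move=> W; have [a ta] := meet Fu Fw; have [b tb] := meet Fv Fw.
    have ai : a <> i by move=> e; apply: nw; apply: sameS; rewrite -e.
    have bi : b <> i by move=> e; apply: nw; apply: sameT (sameS ti); apply: sameS; rewrite -e.
    have ab : a <> b.
      move=> e; subst b; have uv : T (f a u) (f a v) by exact: sameT ta (sameS tb).
      by case: (ix_cases a D) ai uv => -> //.
    case: (ix_cases a D) ai ab ta => -> // _ ab ta; case: (ix_cases b D) bi ab tb => -> // _ _ tb.
    + exact: (W j k).
    + by apply: (W k j) => //; [exact: distinct132|exact: nesym].
  exists (fun l => if eq_ix l i then w else if eq_ix l j then v else u).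
  exists (fun l => if eq_ix l k then v else u) => l.
  have eqs a : eq_ix a a = true by case: a.
  have ne a b : a <> b -> eq_ix a b = false by move=> h; case: eq_ixP.
  have kj := nesym jk; have ki := nesym ik; have ji := nesym ij.
  have E := (eqs, ne _ _ ij, ne _ _ ik, ne _ _ jk, ne _ _ kj, ne _ _ ki, ne _ _ ji).
  case: (ix_cases l D) => ->; rewrite !E.
  + by split=> // a; case: (ix_cases a D) => -> // _; rewrite !E //; exact: sameS.
  + split=> //; first by move/sameS.
    by move=> a; case: (ix_cases a D) => -> // _; rewrite !E //; exact: sameS.
  + by split=> // a; case: (ix_cases a D) => -> // _; rewrite !E //; exact: sameS.
- exfalso.
  have two u v i j : F u -> F v -> i <> j -> T (f i u) (f i v) \/ T (f j u) (f j v).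
    move=> Fu Fv ij; apply: contrapT => /not_orP[ni nj].
    have [k D] := ix_third ij; have [l tl] := meet Fu Fv.
    case: (ix_cases l D) tl => -> // tk; apply: no.
    by exists k, i, j, u, v; split=> //; exact: distinct312.
  have [u [v [Fu Fv n1]]] := nostar I1.
  have t2 : T (f I2 u) (f I2 v) by case: (two u v I1 I2 Fu Fv).
  have [w Fw nw] : exists2 w, F w & ~ T (f I2 w) (f I2 u).
    have [a [b [Fa Fb nab]]] := nostar I2.
    have [ta|na] := pselect (T (f I2 a) (f I2 u)); last by exists a.
    by exists b => // tb; apply: nab; apply: sameT ta (sameS tb).
  have wu : T (f I1 w) (f I1 u) by case: (two w u I1 I2 Fw Fu).
  have wv : T (f I1 w) (f I1 v).
    case: (two w v I1 I2 Fw Fv) => // h; case: nw; exact: sameT h (sameS t2).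
  by apply: n1; apply: sameT (sameS wu) wv.
Qed.
End Triad.

(** ** Scales *)

Section AtPoint.
Variables (R : realType) (X : Type) (d : X -> X -> R) (g : ix -> X -> X) (lam : R).
Hypothesis sys : system d g lam.
Let dxx := dxx sys.
Let dge0 := dge0 sys.
Let dsym := dsym sys.
Let dtri := dtri sys.
Let gC := gC sys.
Notation Orb := (in_orbit g).
Notation contr := (contracts d g lam).
Notation rho := (displacement d g).

Variables (p : X) (nu : R).

Definition opt_step (o : option ix) x := if o is Some i then g i x else x.
(** Words of length at most three; there are 64 of them with this encoding. *)
Definition word := (option ix * option ix * option ix)%type.
Definition word_point (t : word) := opt_step t.1.1 (opt_step t.1.2 (opt_step t.2 p)).
Definition in_picture x := exists a, word_point a = x.
Definition shallow x := exists a c, x = opt_step a (opt_step c p).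

Variables (b r eps : R).
(** Coincidence and nearness in the picture at p. Two points at distance at most
    2 r agree up to eps in a coordinate; 6 eps leaves room for comparing two
    values by way of points outside the picture. *)
Definition merged := chain d word_point (6 * eps).
Definition nearby := chain d word_point b p.

(** A chain of near points stays within 64 b < r of p, and even 400 eps is
    negligible with respect to nu. *)
Hypothesis nu0 : 0 < nu.
Hypothesis hb : b = 1000 * nu.
Hypothesis hr : r = 100 * b.
Hypothesis heps : eps = lam * (2 * r).
Hypothesis low : forall u, Orb p u -> nu <= rho u.
Hypothesis high : rho p <= 2 * nu.

Lemma eps_ge0 : 0 <= eps.
Proof. by rewrite heps; apply: mulr_ge0; [apply/ltW/(lam_gt0 sys)|have := nu0; rewrite hr hb; lra]. Qed.

Lemma eps_small : eps <= nu / 1000 / 1000.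
Proof.
have h : 0 <= 2 * r by have := nu0; rewrite hr hb; lra.
have := lam_negligible sys h (c := 1 / 1000 / 1000 / 1000 / 1000) (lexx _).
by rewrite heps hr hb; have := nu0; lra.
Qed.

Lemma card_word : #|{: word}| = 64%N.
Proof. by rewrite !card_prod !card_option card_ix. Qed.

Lemma merged_dist x y : merged x y -> d x y <= 384 * eps.
Proof.
move=> h; have e6 : 0 <= 6 * eps by have := eps_ge0; lra.
by have := chain_dist dxx dtri e6 h; rewrite card_word; lra.
Qed.

Lemma nearby_dist x : nearby x -> d p x <= 64 * b.
Proof.
move=> h; have b0 : 0 <= b by have := nu0; rewrite hb; lra.
by have := chain_dist dxx dtri b0 h; rewrite card_word.
Qed.

Lemma shallow_image x i : shallow x -> in_picture (g i x).
Proof. by move=> [a [c ->]]; exists (Some i, a, c). Qed.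

Lemma shallow_in_picture x : shallow x -> in_picture x.
Proof. by move=> [a [c ->]]; exists (None, a, c). Qed.

Lemma shallow_base : shallow p. Proof. by exists None, None. Qed.
Lemma shallow_step i : shallow (g i p). Proof. by exists None, (Some i). Qed.

Lemma shallow_orbit x : shallow x -> Orb p x.
Proof.
by move=> [a [c ->]]; exists (seq.pmap id [:: a; c]); case: a c => [i|] [j|].
Qed.

Lemma nearby_in_picture x : nearby x -> in_picture x.
Proof. by case=> [<-|[a [c [_ <- _]]]]; [exact: (shallow_in_picture shallow_base)|exists c]. Qed.

Lemma close_merged x y : in_picture x -> in_picture y -> d x y <= 6 * eps -> merged x y.
Proof. by move=> [a <-] [c <-]; exact: chain_hop. Qed.

Lemma merged_refl x : merged x x. Proof. exact: chain_refl. Qed.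
Lemma merged_sym x y : merged x y -> merged y x. Proof. exact: chain_sym. Qed.
Lemma merged_trans y x z : merged x y -> merged y z -> merged x z.
Proof. by apply: chain_trans => //; have := eps_ge0; lra. Qed.

Lemma nearby_chain x y : nearby x -> chain d word_point b x y -> nearby y.
Proof. by apply: chain_trans => //; have := nu0; rewrite hb; lra. Qed.

Lemma nearby_merged x y : nearby x -> merged x y -> nearby y.
Proof.
move=> Bx xy; apply: nearby_chain Bx _; apply: chain_mono xy.
by have := eps_small; have := nu0; rewrite hb; lra.
Qed.

Lemma nearby_step i : nearby (g i p).
Proof.
have [a pa] := shallow_in_picture shallow_base; have [c pc] := shallow_in_picture (shallow_step i).
apply: nearby_chain (chain_refl d word_point b p) _; rewrite -{1}pa -pc; apply: chain_hop; rewrite pa pc.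
by have := displacement_ge d g p i; have := high; have := nu0; rewrite hb; lra.
Qed.

Lemma some_agreement x u : d x u <= 2 * r -> exists i, d (g i x) (g i u) <= eps.
Proof.
move=> h; have [i hi] := contractive sys x u; exists i.
by apply: le_trans hi _; rewrite heps; apply: (lam_monotone sys).
Qed.

Lemma almost_fixed_absurd x e : Orb p x -> (forall i, d x (g i x) <= e) -> e < nu -> False.
Proof. by move=> ox h en; have := low ox; have := displacement_le (d := d) (g := g) h; lra. Qed.

Lemma far_dist x y : nearby x -> in_picture y -> ~ nearby y -> b < d x y.
Proof.
move=> Bx [c <-] nB; rewrite ltNge; apply/negP => h; apply: nB.
have [a pa] := nearby_in_picture Bx; apply: nearby_chain Bx _; rewrite -pa; apply: chain_hop; by rewrite pa.
Qed.

(** With D = d(p, Z), the relevant error is of the order of lam (D + 80 b). It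
    is small with respect to the distance of Z to the near points, whether D
    is comparable to b or much larger. *)
Lemma far_scales_at_base x i : shallow x -> ~ nearby (g i x) -> exists nr fr, scales g shallow merged nearby (g i x) nr fr.
Proof.
move=> okx nB; move: (shallow_image i okx) nB; move: (g i x) => Z SZ nBZ.
have e0 := eps_ge0; have es := eps_small; have n0 := nu0; have hb' := hb.
have l0 := lam_gt0 sys; have pZ := dge0 p Z.
pose kap := lam * (d p Z + 80 * b) + 384 * eps.
have DZ0 : 0 <= d p Z + 80 * b by lra.
have k0 : 0 <= kap by rewrite /kap; have := mulr_ge0 (ltW l0) DZ0; lra.
exists (fun v => exists2 w, nearby w & d v w <= kap), (fun v => d v Z <= kap); split.
- move=> v [w Bw vw] vZ; have h1 := far_dist Bw SZ nBZ; have h2 := nearby_dist Bw.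
  have := dtri v w Z; have := dtri w p Z; rewrite (dsym w v).
  have := lam_negligible sys DZ0 (c := 1 / 1000); move: vw vZ; rewrite /kap; lra.
- by move=> v Bv; exists v; rewrite ?dxx.
- by move=> v /merged_dist h; rewrite /kap; have := mulr_ge0 (ltW l0) DZ0; lra.
- move=> w V okw okV Bw /merged_dist VZ; have [l hl] := contractive sys w V; exists l.
  have wV : d w V <= d p Z + 80 * b.
    have := nearby_dist Bw; have := dtri p w V; have := dtri Z p V; rewrite (dsym w p) (dsym Z V); lra.
  have {}hl : d (g l w) (g l V) <= lam * (d p Z + 80 * b).
    by apply: le_trans hl _; apply: (lam_monotone sys).
  split=> [Bl|/merged_dist lZ].
    by exists (g l w) => //; rewrite dsym /kap; lra.
  by have := dtri (g l w) (g l V) Z; rewrite (dsym (g l V) (g l w)) /kap; lra.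
Qed.

Lemma picture_at_base : local_picture g p shallow merged nearby.
Proof.
split; try exact: merged_refl; try exact: merged_sym; try exact: merged_trans; try exact: nearby_merged; try exact: shallow_base;
  try exact: shallow_step; try exact: nearby_step; try exact: far_scales_at_base; try exact: gC.
- by move=> i j; exists (Some i), (Some j).
- exact: chain_refl.
- move=> x okx h; apply: (@almost_fixed_absurd x (384 * eps)) (shallow_orbit okx) _ _ => [i|].
    exact: merged_dist.
  by have := eps_small; have := nu0; lra.
Qed.

(** Values of points outside the picture. They determine a class of [merged],
    since 4 eps <= 6 eps. *)
Definition approx v s := exists s', [/\ in_picture s', merged s s' & d v s' <= 2 * eps].

Lemma approx_merged v s s' : approx v s -> merged s s' -> approx v s'.
Proof. by move=> [t [St st vt]] ss'; exists t; split=> //; apply: merged_trans st; exact: merged_sym. Qed.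

Lemma approx_unique v s s' : approx v s -> approx v s' -> merged s s'.
Proof.
move=> [t [St st vt]] [t' [St' st' vt']]; apply: merged_trans st (merged_trans _ (merged_sym st')).
by apply: close_merged => //; have := eps_ge0; have := dtri v t t'; rewrite (dsym t v); lra.
Qed.

Lemma approx_in_picture v s : in_picture v -> approx v s -> merged v s.
Proof.
move=> Sv [t [St st vt]]; apply: merged_trans (merged_sym st); apply: close_merged => //.
by have := eps_ge0; lra.
Qed.

Lemma approx_dist v s : approx v s -> d v s <= 400 * eps.
Proof.
move=> [t [St /merged_dist st vt]]; have := dtri t v s; rewrite (dsym t s).
by have := eps_ge0; lra.
Qed.

Lemma close_approx v s : in_picture s -> d v s <= 2 * eps -> approx v s.
Proof. by move=> Ss h; exists s; split=> //; exact: merged_refl. Qed.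

Definition around w := Orb p w /\ d p w <= r.

Lemma shallow_around w : shallow w -> nearby w -> around w.
Proof.
move=> okw /nearby_dist h; split; first exact: shallow_orbit.
by have := nu0; rewrite hr hb; rewrite hb in h; lra.
Qed.

Lemma around_dist w u : around w -> around u -> d w u <= 2 * r.
Proof. by move=> [_ hw] [_ hu]; have := dtri p w u; rewrite (dsym w p); lra. Qed.

Definition neighbour w := w = p \/ exists i, w = g i p.

Lemma neighbour_nearby w : neighbour w -> shallow w /\ nearby w.
Proof.
case=> [->|[i ->]]; first by split; [exact: shallow_base|exact: chain_refl].
by split; [exact: shallow_step|exact: nearby_step].
Qed.

Lemma neighbour_agree w u : neighbour w -> around u -> exists i, d (g i u) (g i w) <= eps.
Proof. by move=> /neighbour_nearby[okw Bw] bu; exact: some_agreement (around_dist bu (shallow_around okw Bw)). Qed.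

Lemma contracted_approx v s : in_picture s -> d v s <= eps -> approx v s.
Proof. by move=> Ss h; apply: close_approx => //; have := eps_ge0; lra. Qed.

(** If the coordinate i were constant on p, f_1 p, f_2 p, f_3 p, then f_i p
    would not move. *)
Lemma neighbours_have_centre : exists x P : ix -> X, forall i,
  [/\ neighbour (x i), neighbour (P i), ~ merged (g i (x i)) (g i (P i)) &
      forall j, i <> j -> merged (g i (x j)) (g i (P i))].
Proof.
apply: triad merged_refl merged_sym merged_trans _ _ _ => [u v nu' nv|i].
  have [oku Bu] := neighbour_nearby nu'.
  have [okv _] := neighbour_nearby nv; have [i hi] := neighbour_agree nv (shallow_around oku Bu); exists i.
  exact: approx_in_picture (shallow_image i oku) (contracted_approx (shallow_image i okv) hi).
apply: contrapT => no; have all u v : neighbour u -> neighbour v -> merged (g i u) (g i v).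
  by move=> nu' nv; apply: contrapT => n; apply: no; exists u, v.
apply: (moving picture_at_base (shallow_step i)) => l; rewrite gC; apply: all; first by left.
by right; exists l.
Qed.

Definition two_far_pattern (lab : X -> ix -> bool) (v : ix -> bool -> X) i j k :=
  [/\ distinct3 i j k, nearby (v i true), ~ nearby (v j true), ~ nearby (v k true) &
      merged (v j false) (v k false) /\ merged (v j false) (v i true)].

(** The labelling of the points around p in the binary case. [label_all] keeps
    track of the fact that all four even types do occur. *)
Record fano (lab : X -> ix -> bool) (v : ix -> bool -> X) : Prop := Fano {
  value_in_picture : forall i c, in_picture (v i c);
  value0 : forall i, v i false = g i p;
  values_differ : forall i, ~ merged (v i false) (v i true);
  label_value : forall w i, around w -> approx (g i w) (v i (lab w i));
  label_parity : forall w i j k, around w -> distinct3 i j k -> lab w i = lab w j (+) lab w k;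
  label_all : forall t, exists2 w, around w & forall i, lab w i = even_word t i }.

(** Let x_i be the three neighbours of p departing from the centre P. A point
    around p either has two coordinates at P, or all three at f_i x_i. If
    the latter never occurs, [majority_centre] and [common_centre_absurd]
    apply. Otherwise fix w0 of this kind: comparison with w0 shows that
    every point around p has an odd number of coordinates at f_i x_i
    ([code]); labels are codes relative to the one of p. *)
Lemma not_majority_fano : exists lab v, fano lab v.
Proof.
have [x [P hxP]] := neighbours_have_centre.
pose c i := g i (P i); pose s i := g i (x i).
have okP i : shallow (P i) by have [_ /neighbour_nearby[]] := hxP i.
have okx i : shallow (x i) by have [/neighbour_nearby[]] := hxP i.
have xball i : around (x i) by have [/neighbour_nearby[s1 s2 _ _ _]] := hxP i; exact: shallow_around.
have Sc i : in_picture (c i) by exact: shallow_image.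
have Ss i : in_picture (s i) by exact: shallow_image.
have ne i : ~ merged (s i) (c i) by have [] := hxP i.
have meetx w m : around w -> d (g m w) (s m) <= eps \/ exists2 l, l <> m & approx (g l w) (c l).
  move=> bw; have [nx _ _ _] := hxP m; have [l hl] := neighbour_agree nx bw.
  have [e|lm] := pselect (l = m); first by left; rewrite e in hl.
  right; exists l => //; have [_ _ _ h] := hxP l.
  by apply: approx_merged (contracted_approx (shallow_image l (okx m)) hl) _; exact: h.
have dich w : around w -> (forall i j, i <> j -> approx (g i w) (c i) \/ approx (g j w) (c j)) \/
    (forall i, d (g i w) (s i) <= eps).
  move=> bw; have [[a ha]|no] := pselect (exists a, approx (g a w) (c a)); last first.
    by right=> i; have [//|[l _ hl]] := meetx w i bw; case: no; exists l.
  left=> i j ij; have [|ni] := pselect (approx (g i w) (c i)); first by left.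
  right; apply: contrapT => nj.
  have [k D] := ix_third ij; have [_ ik jk] := D.
  have ka : a = k by case: (ix_cases a D) ha => ->.
  subst a; have [h|[l lk hl]] := meetx w k bw.
    by apply: (ne k); exact: approx_unique (contracted_approx (Ss k) h) ha.
  by case: (ix_cases l D) lk hl => ->.
have [allmaj|] := pselect (forall w, around w -> forall i j, i <> j -> approx (g i w) (c i) \/ approx (g j w) (c j)).
  exfalso.
  have Teq : forall i j, merged (c i) (c j).
    refine (majority_centre picture_at_base (P := c) _) => w i j okw Bw ij.
    by case: (allmaj w (shallow_around okw Bw) i j ij) => h; [left|right]; apply: approx_in_picture h; exact: shallow_image.
  have [i [okc Bc]] : exists i, merged (g i p) (c i) /\ nearby (c i).
    have bp : around p by apply: shallow_around shallow_base _; exact: chain_refl.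
    have i12 : I1 <> I2 by [].
    by case: (allmaj p bp _ _ i12) => /(approx_in_picture (shallow_image _ shallow_base)) h; eexists; split; try exact: h; exact: nearby_merged (nearby_step _) h.
  have n0 := nu0; have e0 := eps_ge0; have es := eps_small; have hb' := hb; have hr' := hr.
  have pc := nearby_dist Bc.
  apply: (@common_centre_absurd R X d g lam sys p (c i) nu (600 * eps) (64 * b) nu0 low high pc).
  - have b0 : 0 <= 64 * b by lra.
    by have := lam_negligible sys b0 (c := 1 / 1000 / 1000 / 1000) _; lra.
  - lra.
  - lra.
  - by exists (g i p); [exact: orb_g|have := merged_dist okc; lra].
  - move=> w j k ow wc jk.
    have bw : around w by split=> //; have := dtri (c i) p w; rewrite (dsym (c i) w); lra.
    have near l : approx (g l w) (c l) -> d (g l w) (c i) <= 600 * eps.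
      by move=> h; have := approx_dist (approx_merged h (Teq l i)); lra.
    by case: (allmaj w bw j k jk) => /near; [left|right].
move=> /existsNP[w0 /not_implyP[bw0 /existsNP[i0 /existsNP[j0 /not_implyP[ij0 n0]]]]].
have all0 i : d (g i w0) (s i) <= eps.
  by case: (dich w0 bw0) => // h; case: n0; exact: h.
pose code w i := `[< approx (g i w) (s i) >].
have codeT w i : code w i -> approx (g i w) (s i) by move/asboolP.
have codec w i : approx (g i w) (c i) -> code w i = false.
  by move=> h; apply/asboolP => h'; apply: (ne i); exact: approx_unique h' h.
have meet0 w : around w -> exists i, code w i.
  move=> bw; have [i hi] := some_agreement (around_dist bw bw0); exists i; apply/asboolP.
  apply: close_approx => //; have := dtri (g i w0) (g i w) (s i); have := all0 i; lra.
have codeP w : around w -> (forall i, code w i = false -> approx (g i w) (c i)) /\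
    forall i j k, distinct3 i j k -> code w i (+) code w j (+) code w k.
  move=> bw; case: (dich w bw) => [mj|al]; last first.
    have ct i : code w i by apply/asboolP; exact: contracted_approx.
    by split=> [i|i j k _]; rewrite !ct.
  have [a ha] := meet0 w bw.
  have off j : j <> a -> approx (g j w) (c j).
    by move=> ja; case: (mj a j (nesym ja)) => // /codec; rewrite ha.
  have one i : code w i = eq_ix i a.
    by case: eq_ixP => [->//|ia]; apply: codec; exact: off.
  split=> [i|i j k D]; first by rewrite one; case: eq_ixP => // ia _; exact: off.
  have [ij ik jk] := D; rewrite !one.
  have E l l' : l <> l' -> eq_ix l l' = false by move=> h; case: eq_ixP.
  have E0 l : eq_ix l l by case: l.
  by case: (ix_cases a D) => ->; rewrite ?E0 ?(E _ _ ij) ?(E _ _ ik) ?(E _ _ jk)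
    ?(E _ _ (nesym ij)) ?(E _ _ (nesym ik)) ?(E _ _ (nesym jk)).
have bp : around p by apply: shallow_around shallow_base _; exact: chain_refl.
have [cp pp] := codeP p bp.
pose al i := if code p i then c i else s i.
pose be i := if code p i then s i else c i.
have pbe i : merged (g i p) (be i).
  apply: approx_in_picture; first exact: (shallow_image i shallow_base).
  by rewrite /be; case: (boolP (code p i)) => [/codeT//|/negbTE]; exact: cp.
have abe i : ~ merged (be i) (al i) by rewrite /be /al; case: (code p i) => [|/merged_sym]; exact: ne.
exists (fun w i => code w i (+) code p i), (fun i e => if e then al i else g i p); split.
- move=> i e; rewrite /al; case: e; last exact: (shallow_image i shallow_base).
  by case: (code p i).
- by [].
- by move=> i h; apply: (abe i); apply: merged_trans (merged_sym (pbe i)) h.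
- move=> w i bw; have [cw _] := codeP w bw.
  have h e : code w i = e -> approx (g i w) (if e then s i else c i).
    by case: e => [/codeT|/cw].
  have {h} := h _ erefl; rewrite /al; have := pbe i; rewrite /be.
  case: (code w i); case: (code p i) => //= pb h.
    exact: approx_merged h (merged_sym pb).
  exact: approx_merged h (merged_sym pb).
- move=> w i j k bw D; have [_ pw] := codeP w bw; have := pw _ _ _ D; have := pp _ _ _ D.
  by case: (code w i) (code w j) (code w k) (code p i) (code p j) (code p k) => [] [] [] [] [] [].
- move=> t; pose o i := even_word t i (+) code p i.
  suff [w bw hw] : exists2 w, around w & forall i, code w i = o i.
    by exists w => // i; rewrite hw /o -addbA addbb addbF.
  have D123 : distinct3 I1 I2 I3 by [].
  have class_parity : o I1 (+) o I2 (+) o I3.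
    have := pp _ _ _ D123; rewrite /o; case: t {o} => [[]|] /=;
    by case: (code p I1) (code p I2) (code p I3) => [] [] [].
  have codex m i : code (x m) i = eq_ix i m.
    have [_ _ _ hi] := hxP i; case: eq_ixP => [->|im].
      by apply/asboolP; apply: contracted_approx => //; rewrite dxx; exact: eps_ge0.
    by apply: codec; apply: approx_merged (contracted_approx (shallow_image i (okx m)) _) (hi m im); rewrite dxx; exact: eps_ge0.
  have [[m hm]|no] := pselect (exists m, forall i, o i = eq_ix i m).
    by exists (x m) => // i; rewrite codex hm.
  exists w0 => // i; have -> : code w0 i by apply/asboolP; exact: contracted_approx.
  apply/esym; move: class_parity i; case e1: (o I1); case e2: (o I2); case e3: (o I3) => // _.
  + by case; rewrite ?e1 ?e2 ?e3.
  + by case: no; exists I1; case.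
  + by case: no; exists I2; case.
  + by case: no; exists I3; case.
Qed.

Section FanoCases.
Variables (lab : X -> ix -> bool) (v : ix -> bool -> X).
Hypothesis F : fano lab v.

Lemma around_base : around p.
Proof. by apply: shallow_around shallow_base _; exact: chain_refl. Qed.

Lemma nearby_value0 i : nearby (v i false).
Proof. by rewrite (value0 F); exact: nearby_step. Qed.

Lemma value_unique i c c' : merged (v i c) (v i c') -> c = c'.
Proof. by case: c c' => -[] //= => [/merged_sym|] /(values_differ F). Qed.

Lemma approx_around x s : Orb p x -> approx x s -> nearby s -> around x.
Proof.
move=> ox /approx_dist h1 /nearby_dist h2; split=> //; have := dtri s p x.
by rewrite (dsym s x); have := eps_small; have := nu0; rewrite hr hb in h2 *; lra.
Qed.

Let y i := v i true.
Lemma label_shallow w i : shallow w -> nearby w -> merged (g i w) (if lab w i then y i else g i p).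
Proof.
move=> okw Bw; have := label_value F i (shallow_around okw Bw); have := value0 F i; rewrite /y.
by case: (lab w i) => [_|->]; apply: approx_in_picture; exact: shallow_image.
Qed.

Lemma label_parity_shallow w i j k : shallow w -> nearby w -> distinct3 i j k -> lab w i = lab w j (+) lab w k.
Proof. by move=> okw Bw; apply: (label_parity F); exact: shallow_around. Qed.

Lemma other_value i : ~ merged (g i p) (y i).
Proof. by rewrite -(value0 F); exact: values_differ F i. Qed.

Lemma fano_cases : 
  [\/ exists s : ix -> bool, (forall i c, nearby (v i c)) /\
        forall i j c c', s i (+) c = s j (+) c' -> merged (v i c) (v j c'),
     exists i j k, two_far_pattern lab v i j k |
     (forall i, ~ nearby (v i true)) /\ forall i j, merged (v i true) (v j true)].
Proof.
have D123 : distinct3 I1 I2 I3 by [].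
have vE i c : v i c = if c then y i else g i p by case: c => //; exact: value0 F i.
have [f1|n1] := pselect (nearby (y I1)); have [f2|n2] := pselect (nearby (y I2));
  have [f3|n3] := pselect (nearby (y I3)).
- have By i : nearby (y i) by case: i.
  have [s hs] := all_near picture_at_base other_value label_shallow label_parity_shallow By.
  constructor 1; exists s; split=> [i []|i j c c' e]; [exact: By|exact: nearby_value0|].
  by rewrite !vE; apply: hs.
- by case: (one_far picture_at_base label_shallow D123 f1 f2 n3).
- by case: (one_far picture_at_base label_shallow (distinct132 D123) f1 f3 n2).
- have [h1 h2] := two_far picture_at_base other_value label_shallow label_parity_shallow D123 f1 n2 n3.
  by constructor 2; exists I1, I2, I3; split=> //; rewrite !(value0 F).
- by case: (one_far picture_at_base label_shallow (distinct231 D123) f2 f3 n1).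
- have [h1 h2] := two_far picture_at_base other_value label_shallow label_parity_shallow (distinct213 D123) f2 n1 n3.
  by constructor 2; exists I2, I1, I3; split=> //; rewrite !(value0 F).
- have [h1 h2] := two_far picture_at_base other_value label_shallow label_parity_shallow (distinct312 D123) f3 n1 n2.
  by constructor 2; exists I3, I1, I2; split=> //; rewrite !(value0 F).
- have nB i : ~ nearby (y i) by case: i.
  by constructor 3; split=> // i j; exact: (all_far picture_at_base label_shallow label_parity_shallow nB).
Qed.

(** On x_n = f_i^n p all labels vanish. The points f_j x_n and f_k x_n have
    label 1 at i and opposite labels at j and at k, so they form opposite
    f_i-lines. *)
Lemma two_far_absurd i j k : two_far_pattern lab v i j k -> False.
Proof.
move=> [D Bi nj nk [tjk tji]]; have [ij ik jk] := D.
have Bvi c : nearby (v i c) by case: c => //; exact: nearby_value0.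
pose x n := iter n (g i) p.
have line n : around (x n) /\ forall l, lab (x n) l = false.
  elim: n => [|n [bx lx]].
    split; first exact: around_base.
    move=> l; apply: (@value_unique l); rewrite (value0 F).
    by apply: merged_sym; apply: approx_in_picture (label_value F l around_base); exact: (shallow_image l shallow_base).
  have N0 l : approx (g l (x n)) (v l false) by have := label_value F l bx; rewrite lx.
  have bg l : around (g l (x n)).
    by apply: approx_around (N0 l) (nearby_value0 l); apply: orb_step; case: bx.
  have ll l : l <> i -> lab (g i (x n)) l = false.
    move=> li; have h1 := label_value F l (bg i); have := label_value F i (bg l); rewrite gC.
    move=> /(approx_unique h1) => h; move: h; case: (lab (g i (x n)) l) => // h.
    have Bl : nearby (v l true) by apply: nearby_merged (Bvi _) (merged_sym h).
    by case: (ix_cases l D) li Bl => ->.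
  split=> [|l]; first exact: (bg i).
  have lj := ll j (nesym ij); have lk := ll k (nesym ik).
  by case: (ix_cases l D) => -> //=; rewrite (label_parity F (bg i) D) lj lk.
have bg n l : around (g l (x n)).
  have [bx lx] := line n; apply: (approx_around (s := v l false)); last exact: nearby_value0.
    by apply: orb_step; case: bx.
  by have := label_value F l bx; rewrite lx.
have one l n : l <> i -> merged (v l false) (v i true) -> lab (g l (x n)) i = true.
  move=> li t; apply: (@value_unique i); apply: merged_trans t; apply: (@approx_unique (g i (g l (x n)))).
    exact (label_value F i (bg n l)).
  have [bx lx] := line n.+1; have := label_value F l bx; rewrite lx /x /=; by rewrite gC.
have tki : merged (v k false) (v i true) by apply: merged_trans tji; exact: merged_sym.
pose s n := lab (g j (x n)) k.
have sj n : lab (g j (x n)) j = ~~ s n.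
  have := label_parity F (bg n j) D; rewrite one //; last exact: nesym.
  by rewrite /s; case: (lab _ j); case: (lab _ k).
have sk n : lab (g k (x n)) j = s n.
  have h1 := label_value F k (bg n j); have := label_value F j (bg n k); rewrite gC.
  move/(approx_unique h1); rewrite -/(s n); case: (s n); case: (lab _ j) => // h.
    by case: nk; apply: nearby_merged (nearby_value0 j) (merged_sym h).
  by case: nj; apply: nearby_merged (nearby_value0 k) h.
have skk n : lab (g k (x n)) k = ~~ s n.
  have := label_parity F (bg n k) D; rewrite sk one //; last exact: nesym.
  by case: (s n); case: (lab _ k).
have comm l n : iter n (g i) (g l p) = g l (x n) by rewrite (iterC sys).
have key a c : around a -> around c -> lab a j <> lab c j -> lab a k <> lab c k -> contr i a c.
  move=> ba bc nej nek; have [l hl] := contractive sys a c.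
  have h : d (g l a) (g l c) <= eps.
    by apply: le_trans hl _; rewrite heps; apply: (lam_monotone sys); exact: around_dist.
  have t : lab a l = lab c l.
    apply: (@value_unique l); have [s1 [Ss1 ts1 d1]] := label_value F l ba; have [s2 [Ss2 ts2 d2]] := label_value F l bc.
    apply: merged_trans ts1 (merged_trans _ (merged_sym ts2)); apply: close_merged => //.
    have := dtri (g l a) s1 s2; have := dtri (g l c) (g l a) s2; rewrite (dsym s1 (g l a)).
    by have := eps_ge0; lra.
  by case: (ix_cases l D) hl t => ->.
apply: (opposite_lines sys (i := i) (z := g j p) (z' := g k p) (s := s)) => n m.
  move=> /eqP nm; rewrite !comm; apply: key; rewrite ?sj //.
  by move/(congr1 negb); rewrite !negbK.
move=> nm; rewrite !comm; apply: key; rewrite ?sj ?sk ?skk //.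
  by rewrite nm; case: (s m).
by rewrite -/(s n) nm; case: (s m).
Qed.

(** The two classes of values are the clusters, numbered so that types are even.
    A point of cluster 0 with type 000 would not move: this yields all the
    hypotheses of [two_clusters_absurd]. *)
Lemma near_absurd (s : ix -> bool) : (forall i c, nearby (v i c)) ->
  (forall i j c c', s i (+) c = s j (+) c' -> merged (v i c) (v j c')) -> False.
Proof.
move=> Bv hs; pose q := s I1 (+) s I2 (+) s I3; pose sg i := s i (+) q.
have sgp i j k : distinct3 i j k -> sg i = sg j (+) sg k.
  rewrite /sg /q => -[]; case: i; case: j; case: k => ij ik jk;
    try (by [case: ij|case: ik|case: jk]); by case: (s I1) (s I2) (s I3) => [] [] [].
pose cc e := v I1 (sg I1 (+) e).
have Tcc i c : merged (v i c) (cc (sg i (+) c)).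
  by apply: hs; rewrite /sg; move: (s i) (s I1) (q) c => [] [] [] [].
have ccn : ~ merged (cc false) (cc true) by move/value_unique; case: (sg I1).
pose chi x := `[< approx x (cc true) >].
have chiE x e : approx x (cc e) -> chi x = e.
  case: e => h; first exact/asboolP.
  by apply/asboolP => h'; apply: ccn; exact: approx_unique h h'.
have Nb w i : around w -> approx (g i w) (cc (sg i (+) lab w i)).
  by move=> bw; apply: approx_merged (label_value F i bw) _; exact: Tcc.
have Bcc e : nearby (cc e) by exact: Bv.
have allb x : Orb p x -> around x.
  move: x; apply: orb_ind => [|i x ox bx]; first exact: around_base.
  by apply: (approx_around _ (Nb x i bx)) => //; exact: orb_step.
have stable_orbit x : Orb (g I1 p) x -> Orb p x by apply: orb_trans; exact: orb_g.
have chig x i : Orb p x -> chi (g i x) = sg i (+) lab x i.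
  by move=> ox; apply: chiE; apply: Nb; exact: allb.
have Nc x : Orb (g I1 p) x -> approx x (cc (chi x)).
  move=> /(orb_image sys)[z oz ->]; rewrite chig //; apply: Nb; exact: allb.
have e0 := eps_ge0; have es := eps_small; have n0 := nu0.
have same x u : Orb (g I1 p) x -> Orb (g I1 p) u -> chi x = chi u -> d x u <= 800 * eps.
  move=> /Nc/approx_dist h1 /Nc/approx_dist h2 e; rewrite e in h1.
  by have := dtri (cc (chi u)) x u; rewrite (dsym (cc (chi u)) u); lra.
have stuck x : Orb (g I1 p) x -> ~ (forall i, chi (g i x) = chi x).
  move=> ox h; apply: (almost_fixed_absurd (e := 800 * eps) (stable_orbit x ox)) => [i|]; last lra.
  by apply: same; rewrite ?h //; exact: orb_step.
have sep x u : Orb (g I1 p) x -> Orb (g I1 p) u -> chi x <> chi u -> nu / 2 <= d x u.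
  move=> ox ou ne; have [l hl] := displacement_witness (low (stable_orbit x ox)).
  have oxl : Orb (g I1 p) (g l x) by exact: orb_step.
  have [e|other_value] := eqVneq (chi x) (chi (g l x)); first by have := same _ _ ox oxl e; lra.
  have e : chi (g l x) = chi u by move: ne other_value; case: (chi x) (chi u) (chi (g l x)) => [] [] [].
  have := same _ _ oxl ou e; have := dtri u x (g l x); rewrite (dsym u (g l x)); lra.
have TC : two_clusters d g lam (g I1 p) chi (800 * eps).
  split=> [x i j k ox D|x u i ox ou e h|//].
    have ox' := stable_orbit x ox.
    rewrite !chig // (sgp _ _ _ D) (label_parity F (allb x ox') D).
    by rewrite addbACA.
  apply: contrapT => ne; have := sep _ _ (orb_step i ox) (orb_step i ou) ne.
  have := same _ _ ox ou e; move: h; rewrite /contracts.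
  by have := lam_negligible sys (dge0 x u) (c := 1); lra.
have par3 x i j k : Orb (g I1 p) x -> distinct3 i j k -> chi (g i x) = chi (g j x) (+) chi (g k x).
  by move=> ox D; exact (class_parity TC ox D).
have NC y0 : Orb (g I1 p) y0 -> exists2 z, Orb y0 z & chi z.
  move=> oy; apply: contrapT => no; apply: (stuck y0) => // i.
  have zero z : Orb y0 z -> chi z = false.
    by move=> oz; apply/negP => cz; apply: no; exists z.
  by rewrite !zero //; [exact: orb_refl|exact: orb_g].
apply: (two_clusters_absurd sys TC) => //.
- move=> y0 oy [z [oz cz tz]]; exists z; split=> // i ti.
  have oz' : Orb (g I1 p) z by exact: orb_trans oz.
  by apply: (stuck (g i z)); [exact: orb_step|move=> l; rewrite ti tz].
- move=> y0 oy allN; have [z oz cz] := NC y0 oy.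
  have oz' : Orb (g I1 p) z by exact: orb_trans oz.
  have Nz := allN z oz cz; set x := g I1 z.
  have ox : Orb (g I1 p) x by exact: orb_step.
  have [[k|] tx] := type_exists TC ox; last first.
    by apply: (stuck x) => // l; rewrite tx /x Nz.
  have [i [j D]] := ix_other k; have [ki kj ij] := D.
  have oy0x : Orb y0 x by exact: orb_step.
  have ni := allN _ (orb_step i oy0x) (type_other tx (nesym ki)).
  have nj := allN _ (orb_step j oy0x) (type_other tx (nesym kj)).
  have okx' : Orb (g I1 p) (g k x) by exact: orb_step.
  have ci : chi (g i (g k x)) = false by rewrite gC; exact: ni.
  have cj : chi (g j (g k x)) = false by rewrite gC; exact: nj.
  apply: (stuck (g k x)) => // l; rewrite (negbTE (type_self tx)).
  by case: (ix_cases l D) => -> //; rewrite (par3 _ _ _ _ okx' D) ci cj.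
Qed.

(** The clusters are the surroundings of p and of the far value Z, with radius a
    tenth of D = d(p, Z); the comparison of w with points of all four types
    ([meet]) shows that the images of w lie in the clusters, with even
    parity. The points q of small displacement are near p and have type 000.
    Such a point is terminal: if f_i q had type 000, its images would all be
    at f_i p, where f_i q is. As for the last hypothesis of
    [two_clusters_absurd], either some f_k p is apart from the two other
    images of p, and then the f_k-line of q alternates between the types 000
    and k, or these images nearly coincide, and a point of type 000 among
    the second images of q does not move. *)
Lemma far_structure : (forall i, ~ nearby (v i true)) -> (forall i j, merged (v i true) (v j true)) ->
  (exists M, forall x, Orb p x -> d p x <= M) /\
  ((forall y, Orb p y -> exists2 q, Orb y q & rho q <= 5 * nu) -> False).
Proof.
move=> nB eqZ; pose Z := v I1 true; pose D := d p Z.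
have e0 := eps_ge0; have es := eps_small; have n0 := nu0; have hb' := hb; have hr' := hr.
have Dbig : 1000 * nu < D.
  by have := far_dist (chain_refl d word_point b p) (value_in_picture F I1 true) (nB I1); rewrite hb.
pose near w := d p w <= D / 10; pose far w := d Z w <= D / 10.
have nf w : near w -> far w -> False.
  by rewrite /near /far => h1 h2; have := dtri w p Z; rewrite (dsym w Z) -/D; lra.
have labd w i : around w -> if lab w i then d Z (g i w) <= D / 100 else d p (g i w) <= D / 100.
  move=> bw; have := approx_dist (label_value F i bw); case: (lab w i) => h.
    have := merged_dist (eqZ I1 i); have := dtri (v i true) Z (g i w).
    by rewrite (dsym (v i true) (g i w)) -/Z; lra.
  move: h; rewrite (value0 F) => h; have := dtri (g i p) p (g i w); rewrite (dsym (g i p) (g i w)).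
  by have := displacement_ge d g p i; have := high; lra.
pose chi w := `[< far w >].
have chiF w : far w -> chi w by move/asboolP.
have chiN w : near w -> chi w = false by move=> h; apply/asboolP => /(nf _ h).
have step w : Orb p w -> d p w <= 2 * D -> 
    (forall i, if chi (g i w) then far (g i w) else near (g i w)) /\
    forall i j k, distinct3 i j k -> chi (g i w) = chi (g j w) (+) chi (g k w).
  move=> ow hw.
  have meet t : exists i, if even_word t i then far (g i w) else near (g i w).
    have [u bu hu] := label_all F t; have [i hi] := contractive sys w u; exists i.
    have wu : d w u <= 3 * D + 100 * D.
      by have := dtri p w u; rewrite (dsym w p); have [_] := bu; lra.
    have wu0 : 0 <= 3 * D + 100 * D by lra.
    have := lam_monotone sys wu; have := lam_negligible sys wu0 (c := 1 / 1000 / 1000) _.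
    have := labd u i bu; rewrite hu /near /far; move: hi; rewrite /contracts.
    case: (even_word t i) => hi h.
      by have := dtri (g i u) Z (g i w); rewrite (dsym (g i u)); lra.
    by have := dtri (g i u) p (g i w); rewrite (dsym (g i u)); lra.
  have pick i j k a c : distinct3 i j k -> exists t, [/\ even_word t j = a, even_word t k = c & even_word t i = a (+) c].
    move=> [ij ik jk]; case: a c => -[].
    - by exists (Some i); split; rewrite ?even_word_self // even_word_other //; exact: nesym.
    - by exists (Some k); split; rewrite ?even_word_self // even_word_other.
    - by exists (Some j); split; rewrite ?even_word_self // even_word_other //; exact: nesym.
    - by exists None.
  have wrong l e : e = ~~ chi (g l w) -> (if e then far (g l w) else near (g l w)) -> False.
    by move=> ->; case c: (chi (g l w)) => /= h; [rewrite chiN in c|rewrite chiF in c].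
  have nfi i : if chi (g i w) then far (g i w) else near (g i w).
    have [j [k Dj]] := ix_other i.
    have [t [tj tk _]] := pick i j k (~~ chi (g j w)) (~~ chi (g k w)) Dj.
    have [l hl] := meet t; case: (ix_cases l Dj) hl => ->.
    - by case: (even_word t i) => h; [rewrite chiF|rewrite chiN].
    - by move/wrong => /(_ tj).
    - by move/wrong => /(_ tk).
  split=> // i j k Dj; apply: contrapT => ne.
  have [t [tj tk ti]] := pick i j k (~~ chi (g j w)) (~~ chi (g k w)) Dj.
  have [l hl] := meet t; case: (ix_cases l Dj) hl => -> /wrong; apply => //.
  by rewrite ti; move: ne; case: (chi (g i w)) (chi (g j w)) (chi (g k w)) => [] [] [].
have nfw x : Orb p x -> if chi x then far x else near x.
  move: x; apply: orb_ind => [|i x ox].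
    by rewrite chiN /near ?(dxx p); lra.
  move=> h; have [] // := step x ox.
  move: h; case: (chi x); rewrite /near /far => h; last lra.
  by have := dtri Z p x; rewrite -/D; lra.
have le2D x : Orb p x -> d p x <= 2 * D.
  move/nfw; case: (chi x); rewrite /near /far => h; last lra.
  by have := dtri Z p x; rewrite -/D; lra.
have same x u : Orb p x -> Orb p u -> chi x = chi u -> d x u <= D / 5.
  move=> /nfw hx /nfw hu e; rewrite e in hx; move: hx hu; case: (chi u); rewrite /near /far => h1 h2.
    by have := dtri Z x u; rewrite (dsym x Z); lra.
  by have := dtri p x u; rewrite (dsym x p); lra.
have sep x u : Orb p x -> Orb p u -> chi x <> chi u -> D / 2 <= d x u.
  move=> /nfw hx /nfw hu; move: hx hu; case: (chi u); case: (chi x) => //; rewrite /near /far => h1 h2 _.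
    have := dtri x p Z; have := dtri u x Z; rewrite (dsym u Z) -/D; lra.
  have := dtri u p Z; have := dtri x u Z; rewrite (dsym x Z) (dsym u x) -/D; lra.
have TC : two_clusters d g lam p chi (D / 5).
  split=> [x i j k ox Dj|x u i ox ou e h|//].
    by have [_] := step x ox (le2D x ox); apply.
  apply: contrapT => ne; have := sep _ _ (orb_step i ox) (orb_step i ou) ne.
  have := same _ _ ox ou e; move: h; rewrite /contracts.
  by have := lam_negligible sys (dge0 x u) (c := 1); lra.
split; first by exists (2 * D).
move=> rec; pose E w := Orb p w /\ d p w <= 8 * nu.
have Eb w : E w -> around w by move=> [ow h]; split=> //; lra.
have E0 w i : E w -> chi (g i w) = false -> E (g i w) /\ d (g i p) (g i w) <= 400 * eps.
  move=> Ew c; have bw := Eb w Ew.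
  have l0 : lab w i = false.
    have := labd w i bw; case: (lab w i) => // h; move: c; rewrite chiF // /far; lra.
  have := approx_dist (label_value F i bw); rewrite l0 (value0 F) (dsym (g i w)) => h; split=> //.
  split; first by apply: orb_step; case: Ew.
  by have := dtri (g i p) p (g i w); have := displacement_ge d g p i; have := high; lra.
have recN y1 : Orb p y1 -> exists q, [/\ Orb y1 q, E q, chi q = false & has_type g chi None q].
  move=> oy; have [q oq hq] := rec y1 oy; have opq := orb_trans oy oq.
  have pq := distance_le_displacements sys p q; have h1 := lam_negligible sys (dge0 p q) (c := 1 / 100).
  have hp' := high; have Eq : E q by split=> //; lra.
  exists q; split=> // [|l]; apply: chiN; rewrite /near; have [_ h] := Eq; first lra.
  by have := displacement_ge d g q l; have := dtri q p (g l q); lra.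
have term z i : E z -> has_type g chi None z -> ~ has_type g chi None (g i z).
  move=> Ez tz ti; have [[oi _] hi] := E0 z i Ez (tz i).
  apply: (almost_fixed_absurd (e := 800 * eps) oi) => [l|]; last lra.
  have [El _] := E0 z l Ez (tz l).
  have cil : chi (g i (g l z)) = false by rewrite gC; exact: ti.
  have [_ hil] := E0 _ i El cil; rewrite gC in hil.
  by have := dtri (g i p) (g i z) (g l (g i z)); rewrite (dsym (g i z) (g i p)); lra.
have orbE x : E x -> Orb p x by case.
apply: (two_clusters_absurd sys TC).
- move=> y1 oy; have [q [oq Eq cq tq]] := recN y1 oy; apply: contrapT => no.
  apply: (term q I1 Eq tq) => l; apply/negP => c; apply: no.
  by exists (g l (g I1 q)) => //; do 2! apply: orb_step.
- move=> y1 oy _; have [q [oq Eq cq tq]] := recN y1 oy; exists q; split=> // i; exact: term.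
- move=> y1 oy allN; have [q [oq Eq cq tq]] := recN y1 oy.
  have tN x t : Orb y1 x -> E x -> has_type g chi (Some t) x -> has_type g chi None (g t x) /\ E (g t x).
    move=> ox Ex tx; have [Et _] := E0 x t Ex (negbTE (type_self tx)); split=> //.
    have [j [k Dj]] := ix_other t; have [tj tk jk] := Dj.
    have nj := allN _ (orb_step j ox) (type_other tx (nesym tj)).
    have nk := allN _ (orb_step k ox) (type_other tx (nesym tk)).
    apply: (type_two_zeros TC (orbE _ Et) (distinct231 Dj)); apply/negP; rewrite gC; apply/negP.
      by rewrite (nj t).
    by rewrite (nk t).
  have [[k hk]|no] := pselect (exists k, forall i, i <> k -> 800 * eps < d (g k p) (g i p)).
    have Lk x : Orb y1 x -> E x -> has_type g chi None x -> E (g k x) /\ has_type g chi (Some k) (g k x).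
      move=> ox Ex tx; have [Ek _] := E0 x k Ex (tx k); split=> //.
      have one i : i <> k -> chi (g i (g k x)).
        move=> ik; apply: contrapT => /negP/negbTE c.
        have [_ h1] := E0 _ i Ek c; have [Ei _] := E0 x i Ex (tx i).
        have c' : chi (g k (g i x)) = false by rewrite gC.
        have [_ h2] := E0 _ k Ei c'; rewrite gC in h2.
        have := hk i ik; have := dtri (g i (g k x)) (g k p) (g i p).
        by rewrite (dsym (g i (g k x)) (g i p)); lra.
      have [i [j Dj]] := ix_other k; have [ki kj ij] := Dj.
      by apply: (type_two_ones TC (orbE _ Ek) (distinct231 Dj)); apply: one; exact: nesym.
    pose w n := iter n (g k) q.
    have line n : [/\ Orb y1 (w n), E (w n), chi (w n) = false &
        has_type g chi None (w n) \/ has_type g chi (Some k) (w n)].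
      elim: n => [|n [ow Ew cw tw]]; first by split=> //; left.
      have ck : chi (g k (w n)) = false by case: tw => t; [exact: t|exact: negbTE (type_self t)].
      case: tw => t.
        have [Ek tk] := Lk _ ow Ew t; split=> //; [exact: orb_step|by right].
      have [tk Ek] := tN _ _ ow Ew t; split=> //; [exact: orb_step|by left].
    have [i [j [ki _ _]]] := ix_other k.
    apply: (contracted_line sys (i := k) (z := q)) => n.
    have [ow Ew cw tw] := line n; have [ow' Ew' cw' _] := line n.+1; have [_ _ cw'' _] := line n.+2.
    apply: (contr_agree sys TC (orbE _ Ew) (orbE _ Ew')); first by rewrite -/(w n) cw -/(w n.+1) cw'.
      by rewrite -!iterS -/(w n.+1) -/(w n.+2) cw' cw''.
    exists i; rewrite -/(w n) -/(w n.+1); case: tw => t.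
      have [_ tk] := Lk _ ow Ew t; rewrite (t i) (type_other tk) //; exact: nesym.
    have [tk _] := tN _ _ ow Ew t; rewrite (type_other t (nesym ki)) (tk i) //.
  have part k : exists i, i <> k /\ d (g k p) (g i p) <= 800 * eps.
    apply: contrapT => n; apply: no; exists k => i ik; rewrite ltNge; apply/negP => h.
    by apply: n; exists i.
  have all i j : d (g i p) (g j p) <= 1600 * eps.
    have [->|ij] := pselect (i = j); first by rewrite dxx; lra.
    have [k Dj] := ix_third ij; have [_ ik jk] := Dj.
    have [a [ai ha]] := part i; have [c [cj hc]] := part j.
    case: (ix_cases a Dj) ai ha => -> // _ ha; first lra.
    case: (ix_cases c Dj) cj hc => -> // _ hc; first by rewrite dsym; lra.
    by have := dtri (g k p) (g i p) (g j p); rewrite (dsym (g k p) (g j p)); lra.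
  have [Ex _] := E0 q I1 Eq (tq I1); set x := g I1 q in Ex.
  have ox : Orb y1 x by exact: orb_step.
  have [[t|] tx] := type_exists TC (orbE _ Ex); last by case: (term q I1 Eq tq).
  have [tz Ez] := tN x t ox Ex tx.
  have [_ hz] := E0 x t Ex (negbTE (type_self tx)).
  apply: (almost_fixed_absurd (e := 2400 * eps) (orbE _ Ez)) => [l|]; last lra.
  have [_ hl] := E0 _ l Ez (tz l); have := all t l.
  have := dtri (g t p) (g t x) (g l (g t x)); have := dtri (g l p) (g t p) (g l (g t x)).
  by rewrite (dsym (g t x) (g t p)); lra.
Qed.
End FanoCases.

Theorem local_structure :
  (exists M, forall x, Orb p x -> d p x <= M) /\
  ((forall y, Orb p y -> exists2 q, Orb y q & rho q <= 5 * nu) -> False).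
Proof.
have [lab [v F]] := not_majority_fano.
case: (fano_cases F) => [[s [h1 h2]]|[i [j [k h]]]|[h1 h2]].
- by case: (near_absurd F h1 h2).
- by case: (two_far_absurd F h).
- exact: far_structure F h1 h2.
Qed.
End AtPoint.

(** * Choice of the base point *)

Section NoSystem.
Variables (R : realType) (X : Type) (d : X -> X -> R) (g : ix -> X -> X) (lam : R).
Hypothesis sys : system d g lam.
Notation Orb := (in_orbit g).
Notation rho := (displacement d g).

Lemma displacement_ge0 x : 0 <= rho x.
Proof. exact: le_trans (dge0 sys _ _) (displacement_ge d g x I1). Qed.

Lemma displacement_bounded_below : exists2 c, 0 < c & forall x, c <= rho x.
Proof.
apply: contrapT => no.
have ex n : exists x, rho x < 2^-1 ^+ n.
  apply: contrapT => h; apply: no; exists (2^-1 ^+ n); first by rewrite exprn_gt0 // invr_gt0.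
  by move=> x; rewrite leNgt; apply/negP => hx; apply: h; exists x.
have [u hu] := choice ex.
apply: (no_convergence sys (u := u) (C := 4)) => n; have h := hu n.
  have := hu n.+1; have := distance_le_displacements sys (u n) (u n.+1); rewrite exprSr.
  by have := lam_negligible sys (dge0 sys (u n) (u n.+1)) (c := 1 / 4); have := displacement_ge0 (u n); lra.
by exists I1; have := displacement_ge d g (u n) I1; have := displacement_ge0 (u n); lra.
Qed.

Lemma almost_minimal x : exists2 p, Orb x p & forall u, Orb x u -> rho p <= 2 * rho u.
Proof.
have [c c0 hc] := displacement_bounded_below.
by apply: (almost_min (c := c)) => //; exists x; exact: orb_refl.
Qed.

Lemma at_almost_minimal x p : Orb x p -> (forall u, Orb x u -> rho p <= 2 * rho u) ->
  (exists M, forall w, Orb p w -> d p w <= M) /\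
  ((forall y, Orb p y -> exists2 q, Orb y q & rho q <= 5 * (rho p / 2)) -> False).
Proof.
move=> xp hp; have [c c0 hc] := displacement_bounded_below; have cp := hc p.
apply: (local_structure sys _ erefl erefl erefl) => [|u pu|]; try lra.
by have := hp u (orb_trans xp pu); lra.
Qed.

(** The first base point p1 only serves to know that the orbit is bounded. Then
    t is an almost largest lower bound of the displacement on a sub-orbit
    Orb(y1), so that no sub-orbit has displacements all above 5 nu. *)
Theorem no_system (x : X) : False.
Proof.
have [c c0 hc] := displacement_bounded_below.
have [p1 xp1 hp1] := almost_minimal x.
have [[M hM] _] := at_almost_minimal xp1 hp1.
pose L := [set t : R | exists2 y, Orb p1 y & forall w, Orb y w -> t <= rho w]%classic.
have Lsup : has_sup L.
  split; first by exists c, p1 => //; exact: orb_refl.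
  exists (2 * M) => t [y oy hy]; apply: le_trans (hy y (orb_refl g y)) _.
  apply: displacement_le => l; have := hM _ oy; have := hM _ (orb_step l oy).
  by have := dtri sys p1 y (g l y); rewrite (dsym sys y p1); lra.
have cs : c <= sup L.
  by apply: ub_le_sup; [case: Lsup|exists p1 => //; exact: orb_refl].
have s0 : 0 < sup L / 2 by lra.
have [t [y1 oy1 hy1] ht] := sup_adherent s0 Lsup.
have [p oyp hp] := almost_minimal y1.
have [_] := at_almost_minimal oyp hp; apply=> y oy; apply: contrapT => no.
have : L (5 * (rho p / 2)).
  exists y; first exact: orb_trans oy1 (orb_trans oyp oy).
  by move=> w ow; rewrite leNgt; apply/negP => h; apply: no; exists w => //; exact: ltW.
move=> Lp; have : 5 * (rho p / 2) <= sup L by apply: ub_le_sup Lp; case: Lsup.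
by have := hy1 _ oyp; have := hc p; lra.
Qed.
End NoSystem.

(** * Completeness *)

Section Limits.
Variables (R : realType) (X : completeMetricType R).
Implicit Types (u : nat -> X) (C : R).

Lemma geometric_small C (e : R) : 0 < e -> exists N, forall n, (N <= n)%N -> C * 2^-1 ^+ n < e.
Proof.
move=> e0; exists (Num.bound (C / e)) => n /upper_nthrootP h.
by rewrite exprVn -ltr_pdivlMr ?invr_gt0 ?exprn_gt0// invrK -ltr_pdivrMl // mulrC.
Qed.

Lemma geometric_tail u C : (forall n, mdist (u n) (u n.+1) <= C * 2^-1 ^+ n) ->
  forall n m, (n <= m)%N -> mdist (u n) (u m) <= 2 * C * 2^-1 ^+ n.
Proof.
move=> h n m /subnKC <-; move: (m - n)%N => k {m}.
have C0 : 0 <= C by have := h 0%N; rewrite expr0 mulr1; apply: le_trans; exact: mdist_ge0.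
suff : mdist (u n) (u (n + k)%N) <= 2 * C * (2^-1 ^+ n - 2^-1 ^+ (n + k)).
  move/le_trans; apply; rewrite mulrBr gerBl; apply: mulr_ge0; first lra.
  by rewrite exprn_ge0 // invr_ge0.
elim: k => [|k IH]; first by rewrite addn0 mdistxx subrr mulr0.
rewrite addnS exprS; have := metric_triangle (u n) (u (n + k)%N) (u (n + k).+1).
by have := h (n + k)%N; lra.
Qed.

Lemma geometric_limit u C (g : ix -> X -> X) : (forall i, continuous (g i)) ->
  (forall n, mdist (u n) (u n.+1) <= C * 2^-1 ^+ n) ->
  exists q, forall i, (forall N, exists2 n, (N <= n)%N & mdist (u n) (g i (u n)) <= C * 2^-1 ^+ n) ->
    g i q = q.
Proof.
move=> cg h; have tail := geometric_tail h.
have cu : cvg (u @ \oo).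
  apply/cauchy_cvgP; apply: cauchy_exP => e e0.
  have [N hN] := geometric_small (2 * C) e0.
  exists (u N); exists N => // n /= Nn; rewrite ballEmdist /=.
  by apply: le_lt_trans (tail _ _ Nn) (hN N _).
pose q : X := lim (u @ \oo); exists q => i io.
apply/esym/mdist_positivity/eqP; rewrite eq_le mdist_ge0 andbT leNgt; apply/negP => e0.
set e := mdist q (g i q) in e0.
have e4 : 0 < e / 4 by lra.
have c1 : \forall n \near \oo, mdist q (u n) < e / 4.
  by apply: metricType_numDomainType.cvgr_dist_lt.
have c2 : \forall n \near \oo, mdist (g i q) (g i (u n)) < e / 4.
  apply: metricType_numDomainType.cvgr_dist_lt => //.
  exact: (cvg_comp _ _ cu (cg i q)).
have [N hN] := geometric_small C e4.
have [N' _ hN'] := filterI c1 c2.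
have [n /= Nn hn] := io (maxn N N').
have [h1 h2] := hN' n (leq_trans (leq_maxr _ _) Nn).
have h3 := hN n (leq_trans (leq_maxl _ _) Nn).
have := metric_triangle q (u n) (g i q); have := metric_triangle (u n) (g i (u n)) (g i q).
rewrite (metric_sym (g i (u n))) -/e; lra.
Qed.
End Limits.


(** * A fixed point of one map suffices *)

Section FixedPoint.
Variables (R : realType) (X : completeMetricType R) (lam : R) (g : ix -> X -> X).
Hypothesis lam8 : lam <= 1 / 8.
Hypothesis cg : forall i, continuous (g i).
Hypothesis gC : forall i j x, g i (g j x) = g j (g i x).
Hypothesis contractive : forall x y, exists i, contracts (@mdist R X) g lam i x y.
Notation d := (@mdist R X).
Notation rho := (displacement d g).

(** Among the pairs formed by x, f_j x, f_k x, all of them fixed by f_i, two are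
    contracted by the same map f_l, so that f_l x has at most half the
    displacement of x. *)
Lemma fixed_point_extends i z : g i z = z -> exists x, forall l, g l x = x.
Proof.
move=> gz; have [j [k D]] := ix_other i; have [ij ik jk] := D.
have dge0 x y : 0 <= d x y by exact: mdist_ge0.
have lam_d x y : lam * d x y <= 1 / 8 * d x y by apply: ler_wpM2r.
have tri x y w := metric_triangle (T := X) x y w; have sym := metric_sym (T := X).
have two x y : g i x = x -> g i y = y -> contracts d g lam j x y \/ contracts d g lam k x y.
  move=> ix iy; have [l hl] := contractive x y.
  case: (ix_cases l D) hl => -> hl; [|by left|by right].
  have xy : x = y.
    apply: mdist_positivity; apply/eqP; rewrite eq_le dge0 andbT.
    by have := dge0 x y; have := lam_d x y; move: hl; rewrite /contracts ix iy; lra.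
  by left; rewrite /contracts xy !mdistxx mulr0.
have step x : g i x = x -> exists l, g i (g l x) = g l x /\ rho (g l x) <= rho x / 2.
  move=> ix; have fix_g l : g i (g l x) = g l x by rewrite gC ix.
  have r0 : 0 <= rho x by apply: le_trans (displacement_ge d g x i); exact: dge0.
  have hj := displacement_ge d g x j; have hk := displacement_ge d g x k.
  have e1 := hj; have e2 := hk.
  have e3 : d (g j x) (g k x) <= 2 * rho x by have := tri (g j x) x (g k x); rewrite (sym _ x); lra.
  have small a b l : d a b <= 2 * rho x -> contracts d g lam l a b -> d (g l a) (g l b) <= rho x / 4.
    rewrite /contracts => h1 h2; apply: le_trans h2 _.
    by have := lam_d a b; lra.
  have e1' : d x (g j x) <= 2 * rho x by lra.
  have e2' : d x (g k x) <= 2 * rho x by lra.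
  have good l : d (g l x) (g l (g j x)) <= rho x / 2 -> d (g l x) (g l (g k x)) <= rho x / 2 ->
      exists l, g i (g l x) = g l x /\ rho (g l x) <= rho x / 2.
    move=> h1 h2; exists l; split; first exact: fix_g.
    apply: displacement_le => a; case: (ix_cases a D) => ->.
    - by rewrite fix_g mdistxx; lra.
    - by rewrite (gC j).
    - by rewrite (gC k).
  have pair l : (contracts d g lam l x (g j x) /\ contracts d g lam l x (g k x)) \/
      (contracts d g lam l x (g j x) /\ contracts d g lam l (g j x) (g k x)) \/
      (contracts d g lam l x (g k x) /\ contracts d g lam l (g j x) (g k x)) ->
      exists l, g i (g l x) = g l x /\ rho (g l x) <= rho x / 2.
    case=> [[h1 h2]|[[h1 h2]|[h1 h2]]]; apply: (good l).
    - by have := small _ _ _ e1' h1; lra.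
    - by have := small _ _ _ e2' h2; lra.
    - by have := small _ _ _ e1' h1; lra.
    - have := small _ _ _ e1' h1; have := small _ _ _ e3 h2.
      by have := tri (g l x) (g l (g j x)) (g l (g k x)); lra.
    - have := small _ _ _ e2' h1; have := small _ _ _ e3 h2.
      have := tri (g l x) (g l (g k x)) (g l (g j x)); rewrite (sym (g l (g k x))); lra.
    - by have := small _ _ _ e2' h1; lra.
  have [h1|h1] := two _ _ ix (fix_g j); have [h2|h2] := two _ _ ix (fix_g k);
    have [h3|h3] := two _ _ (fix_g j) (fix_g k).
  - by apply: (pair j); left.
  - by apply: (pair j); left.
  - by apply: (pair j); right; left.
  - by apply: (pair k); right; right.
  - by apply: (pair j); right; right.
  - by apply: (pair k); right; left.
  - by apply: (pair k); left.
  - by apply: (pair k); left.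
pose St n x := g i x = x /\ rho x <= rho z * 2^-1 ^+ n.
have S0 : St 0%N z by split=> //; rewrite expr0 mulr1.
have next n x : St n x -> exists2 x', St n.+1 x' & d x x' <= rho x.
  move=> [ix rx]; have [l [il rl]] := step x ix; exists (g l x); last exact: displacement_ge.
  by split=> //; rewrite exprSr mulrA; lra.
have [u hu] := dependent_choice_nat S0 next.
have du n : d (u n) (u n.+1) <= rho z * 2^-1 ^+ n.
  by have [[_ h] h'] := hu n; exact: le_trans h' h.
have [q hq] := geometric_limit cg du; exists q => l; apply: hq => N; exists N => //.
by have [[_ h] _] := hu N; exact: le_trans (displacement_ge d g _ l) h.
Qed.
End FixedPoint.


Theorem theorem1p4 (R : realType) (X : completeMetricType R) (lambda : R)
    (f : 'I_3 -> X -> X) :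
  0 < lambda -> lambda < 10 ^- 23 ->
  (forall i : 'I_3, continuous (f i)) ->
  commuting_family f ->
  contractive_family lambda f ->
  exists x : X, forall i : 'I_3, f i x = x.
Proof.
move=> l0 l23 cf comm con.
pose g i := f (ix_ord i).
have ordK (k : 'I_3) : ix_ord (ord_ix k) = k.
  by case: k => -[|[|[|//]]] ?; apply: val_inj.
have lsmall : lambda <= 1 / 1000 / 1000 / 1000 / 1000.
  apply: ltW; apply: lt_le_trans l23 _.
  have -> : 1 / 1000 / 1000 / 1000 / 1000 = (10 ^+ 12)^-1 :> R.
    have -> : 1000 = 10 ^+ 3 :> R by rewrite -natrX.
    by rewrite !mul1r -!invfM -!exprD.
  by rewrite lef_pV2 ?posrE ?exprn_gt0 // ler_eXn2l // ltr1n.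
have gC i j x : g i (g j x) = g j (g i x).
  by have := congr1 (fun h => h x) (comm (ix_ord i) (ix_ord j)).
have gcon x y : exists i, contracts (@mdist R X) g lambda i x y.
  by have [k hk] := con x y; exists (ord_ix k); rewrite /contracts /g ordK.
have cg i : continuous (g i) by exact: cf.
have lam8 : lambda <= 1 / 8 by lra.
apply: contrapT => nofix.
have nf i z : g i z <> z.
  move=> e; have [x hx] := fixed_point_extends lam8 cg gC gcon e.
  by apply: nofix; exists x => k; rewrite -(ordK k); exact: hx.
apply: (@no_system R X (@mdist R X) g lambda _ point).
split=> //; [exact: mdistxx|exact: mdist_ge0|exact: metric_sym|by move=> y x z; exact: metric_triangle|].
move=> u C du ex; have [q hq] := geometric_limit cg du.
have late i : exists N, forall n, (N <= n)%N -> ~ (mdist (u n) (g i (u n)) <= C * 2^-1 ^+ n).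
  apply: contrapT => no; apply: (nf i q); apply: hq => N; apply: contrapT => no'.
  by apply: no; exists N => n Nn h; apply: no'; exists n.
have [N hN] := choice late.
have [i] := ex (maxn (N I1) (maxn (N I2) (N I3))).
by apply: hN; case: i; rewrite !leq_max leqnn ?orbT.
Qed.
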